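(* Let $\eta>0$, $\varepsilon_\perp,\varepsilon_\parallel>0$ and consider the uniaxial dielectric tensor $\varepsilon=\varepsilon_\perp I_d+(\varepsilon_\parallel-\varepsilon_\perp)\mathbf{n}\otimes\mathbf{n}$ with director $\mathbf{n}=(\cos\psi\cos\varphi,\cos\psi\sin\varphi,\sin\psi)$, where the tilt angle $\psi:[0,1]\to(-\frac\pi2,\frac\pi2]$ and the azimuthal angle $\varphi:[0,1]\to[0,\pi)$ are piecewise continuous, and $n_0^2=\sqrt{\varepsilon_\perp\varepsilon_\parallel}$. Then the Stokes data (for all $I_1,I_2\in\mathbb{C}$ and all $\theta\in(-\frac\pi2,\frac\pi2)$) do not determine $(\psi,\varphi)$ uniquely. When $\varphi\equiv0$, the data available to determine $\psi$ are exactly the functions $$\lambda\mapsto T(\lambda)F(\lambda)\quad\text{and}\quad\lambda\mapsto T(\lambda)/F(\lambda),\qquad\lambda=\cos\theta\in(0,1],$$ that is, two tilt angles $\psi$ (with $\varphi\equiv0$) have the same Stokes data for all $I_1,I_2,\theta$ if and only if they have the same functions $TF$ and $T/F$ on $(0,1]$. Here $$F(\lambda)=\exp\left(\mathbf{i}\,\eta^{-1}\delta\sqrt{1-\lambda^2}\int_0^1\frac{\sin(2\psi(s))}{1+\delta\cos(2\psi(s))}\,ds\right),\qquad\delta=\frac{\varepsilon_\perp-\varepsilon_\parallel}{\varepsilon_\perp+\varepsilon_\parallel},$$ and $T(\lambda)\in\mathbb{C}$ is defined (together with $R(\lambda)\in\mathbb{C}$) by requiring that there is a continuous solution $(u_1,u_2)$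 of $$\tilde\eta\lambda\frac{du_1}{dt}=\mathbf{i}\left(\lambda^2+\frac{\delta}{\sqrt{1-\delta^2}}\left(\cos(2\psi(\mu(t)))+\frac{\delta}{1+\sqrt{1-\delta^2}}\right)\right)u_2,\qquad \tilde\eta\frac{du_2}{dt}=\mathbf{i}\lambda u_1\quad\text{in }[0,1],$$ $$u_1(0)=1-R(\lambda),\quad u_2(0)=1+R(\lambda),\quad u_1(1)=u_2(1)=T(\lambda),$$ where $\mu(\tau(t))=t$ for all $t\in[0,1]$ and $$\tau(t)=\frac1{\mathcal N}\int_0^t\frac{ds}{1+\delta\cos(2\psi(s))},\quad\mathcal N=\int_0^1\frac{ds}{1+\delta\cos(2\psi(s))},\quad\tilde\eta=\frac{\eta}{\sqrt{1-\delta^2}\,\mathcal N}.$$ Moreover $\psi$ is not uniquely determined by these data: there exist two distinct piecewise continuous tilt angles $\psi_1\ne\psi_2$ with the same functions $TF$ and $T/F$ on $(0,1]$.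
   Context: $\mathbf{i}$ is the imaginary unit. Transmission problem and Stokes data: put $\tilde\varepsilon=\varepsilon/n_0^2$ (a real symmetric $3\times3$ matrix function of $t\in[0,1]$), $\theta\in(-\frac\pi2,\frac\pi2)$ the angle of incidence, $\lambda=\cos\theta$, and $$B=\frac1{\tilde\varepsilon_{33}}\begin{bmatrix}-\sin\theta\,\tilde\varepsilon_{13}&\frac{\lambda^2+\tilde\varepsilon_{33}-1}{\lambda}&0&-\sin\theta\,\lambda^{-1}\tilde\varepsilon_{23}\\ \lambda(\tilde\varepsilon_{11}\tilde\varepsilon_{33}-\tilde\varepsilon_{13}^2)&-\sin\theta\,\tilde\varepsilon_{13}&0&\tilde\varepsilon_{12}\tilde\varepsilon_{33}-\tilde\varepsilon_{13}\tilde\varepsilon_{23}\\ \tilde\varepsilon_{12}\tilde\varepsilon_{33}-\tilde\varepsilon_{13}\tilde\varepsilon_{23}&-\sin\theta\,\lambda^{-1}\tilde\varepsilon_{23}&0&\frac{(\lambda^2+\tilde\varepsilon_{22}-1)\tilde\varepsilon_{33}-\tilde\varepsilon_{23}^2}{\lambda}\\0&0&\lambda\tilde\varepsilon_{33}&0\end{bmatrix}.$$ Given $I_1,I_2\in\mathbb{C}$, the numbers $T_1,T_2,R_1,R_2\in\mathbb{C}$ are the unique ones for which there is a continuous solution $Z:[0,1]\to\mathbb{C}^4$ of $\frac{dZ}{dt}=\frac{\mathbf{i}}{\eta}B(t)Z(t)$ with $Z(0)=[I_1-R_1,I_1+R_1,I_2-R_2,I_2+R_2]^T$ and $Z(1)=[T_1,T_1,T_2,T_2]^T$.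 The Stokes data are $$S(I_1,I_2,\theta)=\left(|T_1|^2+|T_2|^2,\ |T_1|^2-|T_2|^2,\ 2T_1\overline{T_2}\right).$$ The constants $\eta,\varepsilon_\perp,\varepsilon_\parallel$ are known; $\psi,\varphi$ are the unknowns. Differential equations with piecewise continuous coefficients hold away from the discontinuities, with continuous solutions. *)

(* Defs.v *)
(* World: Stdlib reals with Coquelicot. *)
From Stdlib Require Import Reals List ClassicalEpsilon.
From Coquelicot Require Import Coquelicot.
Import ListNotations.
Open Scope R_scope.

(* Definite description.  It is only used for objects which are uniquely
   determined, so that the default value [d] is never reached. *)
Definition the {A : Type} (d : A) (P : A -> Prop) : A :=
  match excluded_middle_informative (exists x, P x) with
  | left h => proj1_sig (constructive_indefinite_description P h)
  | right _ => d
  end.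

Definition unit_interval (t : R) : Prop := 0 <= t <= 1.

(* Finitely many discontinuities, all of them jumps; the values at 0, at 1 and
   at the jumps are arbitrary.  Values outside [0,1] are irrelevant here and
   below. *)
Definition piecewise_continuous (f : R -> R) : Prop :=
  (exists l : list R, forall t, 0 < t < 1 -> ~ In t l -> continuous f t) /\
  (forall t, 0 <= t < 1 -> exists y : R, filterlim f (at_right t) (locally y)) /\
  (forall t, 0 < t <= 1 -> exists y : R, filterlim f (at_left t) (locally y)).

(* Distinct as piecewise continuous functions on [0,1]: changing the values at
   finitely many points does not make a function different. *)
Definition distinct {A : Type} (f g : R -> A) : Prop :=
  forall l : list R, exists t, unit_interval t /\ ~ In t l /\ f t <> g t.

Definition tilt_angle (psi : R -> R) : Prop :=
  piecewise_continuous psi /\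
  forall t, unit_interval t -> - (PI / 2) < psi t <= PI / 2.

Definition azimuthal_angle (phi : R -> R) : Prop :=
  piecewise_continuous phi /\
  forall t, unit_interval t -> 0 <= phi t < PI.

(* Vector and matrix indices start at 0.  The arguments [eperp] and [epar] are
   the dielectric constants orthogonal and parallel to the director; [psi] and
   [phi] are real numbers in [director], [eps], [epst] and [Bmat]. *)
Definition director (psi phi : R) (i : nat) : R :=
  match i with
  | 0%nat => cos psi * cos phi
  | 1%nat => cos psi * sin phi
  | _ => sin psi
  end.

Definition eps (eperp epar psi phi : R) (i j : nat) : R :=
  eperp * (if Nat.eqb i j then 1 else 0) +
  (epar - eperp) * (director psi phi i * director psi phi j).

Definition n0_sq (eperp epar : R) : R := sqrt (eperp * epar).

Definition epst (eperp epar psi phi : R) (i j : nat) : R :=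
  eps eperp epar psi phi i j / n0_sq eperp epar.

Definition Bmat (eperp epar theta psi phi : R) (i j : nat) : R :=
  let e := epst eperp epar psi phi in
  let e11 := e 0%nat 0%nat in let e12 := e 0%nat 1%nat in
  let e13 := e 0%nat 2%nat in let e22 := e 1%nat 1%nat in
  let e23 := e 1%nat 2%nat in let e33 := e 2%nat 2%nat in
  let la := cos theta in
  / e33 *
  nth j (nth i
   [ [ - sin theta * e13;
       (la ^ 2 + e33 - 1) / la;
       0;
       - sin theta * / la * e23 ];
     [ la * (e11 * e33 - e13 ^ 2);
       - sin theta * e13;
       0;
       e12 * e33 - e13 * e23 ];
     [ e12 * e33 - e13 * e23;
       - sin theta * / la * e23;
       0;
       ((la ^ 2 + e22 - 1) * e33 - e23 ^ 2) / la ];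
     [ 0; 0; la * e33; 0 ] ] nil) 0.

Definition transmission_solution (eta eperp epar : R) (psi phi : R -> R)
    (theta : R) (Z : nat -> R -> C) : Prop :=
  let B := fun t => Bmat eperp epar theta (psi t) (phi t) in
  (forall i, (i < 4)%nat -> continuous_on unit_interval (Z i)) /\
  (forall t, 0 < t < 1 ->
     (forall i j, (i < 4)%nat -> (j < 4)%nat -> continuous (fun s => B s i j) t) ->
     forall i, (i < 4)%nat ->
       is_derive (Z i) t
         (Ci / eta * sum_n (fun j => (B t i j * Z j t)%C) 3)%C).

(* The quadruple (T1, T2, R1, R2). *)
Definition transmission (eta eperp epar : R) (psi phi : R -> R)
    (I1 I2 : C) (theta : R) : C * C * C * C :=
  the (RtoC 0, RtoC 0, RtoC 0, RtoC 0) (fun '(T1, T2, R1, R2) =>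
    exists Z : nat -> R -> C,
      transmission_solution eta eperp epar psi phi theta Z /\
      Z 0%nat 0 = (I1 - R1)%C /\ Z 1%nat 0 = (I1 + R1)%C /\
      Z 2%nat 0 = (I2 - R2)%C /\ Z 3%nat 0 = (I2 + R2)%C /\
      Z 0%nat 1 = T1 /\ Z 1%nat 1 = T1 /\ Z 2%nat 1 = T2 /\ Z 3%nat 1 = T2).

Definition Stokes (eta eperp epar : R) (psi phi : R -> R)
    (I1 I2 : C) (theta : R) : R * R * C :=
  let '(T1, T2, _, _) := transmission eta eperp epar psi phi I1 I2 theta in
  (Cmod T1 ^ 2 + Cmod T2 ^ 2, Cmod T1 ^ 2 - Cmod T2 ^ 2, (2 * T1 * Cconj T2)%C).

Definition same_Stokes (eta eperp epar : R) (psi1 phi1 psi2 phi2 : R -> R) : Prop :=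
  forall (I1 I2 : C) (theta : R), - (PI / 2) < theta < PI / 2 ->
    Stokes eta eperp epar psi1 phi1 I1 I2 theta =
    Stokes eta eperp epar psi2 phi2 I1 I2 theta.

Definition delta (eperp epar : R) : R := (eperp - epar) / (eperp + epar).

(* exp (i x) for real x. *)
Definition Cexpi (x : R) : C := (cos x, sin x).

Definition Ffun (eta eperp epar : R) (psi : R -> R) (la : R) : C :=
  let d := delta eperp epar in
  Cexpi (/ eta * d * sqrt (1 - la ^ 2) *
         RInt (fun s => sin (2 * psi s) / (1 + d * cos (2 * psi s))) 0 1).

Definition Ncal (d : R) (psi : R -> R) : R :=
  RInt (fun s => / (1 + d * cos (2 * psi s))) 0 1.

Definition tau (d : R) (psi : R -> R) (t : R) : R :=
  / Ncal d psi * RInt (fun s => / (1 + d * cos (2 * psi s))) 0 t.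

(* The inverse of the increasing bijection [tau d psi] of [0,1]. *)
Definition mu (d : R) (psi : R -> R) (s : R) : R :=
  the 0 (fun t => unit_interval t /\ tau d psi t = s).

Definition eta_tilde (eta d : R) (psi : R -> R) : R :=
  eta / (sqrt (1 - d ^ 2) * Ncal d psi).

Definition reduced_solution (eta d : R) (psi : R -> R) (la : R)
    (u1 u2 : R -> C) : Prop :=
  let et := eta_tilde eta d psi in
  let q := fun t =>
    la ^ 2 + d / sqrt (1 - d ^ 2) *
             (cos (2 * psi (mu d psi t)) + d / (1 + sqrt (1 - d ^ 2))) in
  continuous_on unit_interval u1 /\ continuous_on unit_interval u2 /\
  (forall t, 0 < t < 1 -> continuous q t ->
     exists du1 du2 : C,
       is_derive u1 t du1 /\ is_derive u2 t du2 /\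
       (et * la * du1 = Ci * q t * u2 t)%C /\
       (et * du2 = Ci * la * u1 t)%C).

(* The pair (T(la), R(la)). *)
Definition reduced_transmission (eta eperp epar : R) (psi : R -> R) (la : R) : C * C :=
  the (RtoC 0, RtoC 0) (fun '(T, R0) =>
    exists u1 u2 : R -> C,
      reduced_solution eta (delta eperp epar) psi la u1 u2 /\
      u1 0 = (1 - R0)%C /\ u2 0 = (1 + R0)%C /\ u1 1 = T /\ u2 1 = T).

Definition Tfun (eta eperp epar : R) (psi : R -> R) (la : R) : C :=
  fst (reduced_transmission eta eperp epar psi la).

Definition same_TF (eta eperp epar : R) (psi1 psi2 : R -> R) : Prop :=
  forall la : R, 0 < la <= 1 ->
    (Tfun eta eperp epar psi1 la * Ffun eta eperp epar psi1 la =
     Tfun eta eperp epar psi2 la * Ffun eta eperp epar psi2 la)%C /\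
    (Tfun eta eperp epar psi1 la / Ffun eta eperp epar psi1 la =
     Tfun eta eperp epar psi2 la / Ffun eta eperp epar psi2 la)%C.

(* Main.v *)
(* For phi = 0 the matrix B splits into two 2x2 blocks, for (Z0, Z1) and (Z2, Z3).  The
   second block does not depend on psi and is solved explicitly.  The first becomes the
   reduced system after removing its diagonal by the gauge factor exp(i G), where
   G(t) = (delta sin theta / eta) int_0^t sin(2 psi) / (1 + delta cos(2 psi)), and changing
   time by tau; hence T1 = I1 T F for theta >= 0, T1 = I1 T / F for theta <= 0, and the
   product 2 T1 conj(T2) recovers TF and T/F.

   Uniqueness of T and R is conservation of the flux Re(u conj v), which reads
   |T|^2 + |R|^2 = |I|^2.  Existence is not needed for the nontrivial block: when the
   boundary value problem has no solution, the numbers T1, T2 and T take their default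
   value 0, whereas T <> 0 when it has one (Gronwall), so both kinds of data detect
   solvability.

   The data are insensitive to psi -> -psi when the integral in F vanishes, for instance
   for psi(t) = t - 1/2; and a vertical director (psi = pi/2) has no azimuth. *)
Require Import Defs.
From Stdlib Require Import Reals List Lra Lia.
From Stdlib Require Import FunctionalExtensionality PropExtensionality ClassicalEpsilon.
From Coquelicot Require Import Coquelicot.
Open Scope R_scope.

(** * Calculus with finitely many exceptional points *)

Lemma filterlim_C {T} (F : (T -> Prop) -> Prop) {FF : Filter F} (f : T -> C) (z : C) :
  filterlim f F (locally z) <->
  filterlim (fun t => Re (f t)) F (locally (Re z)) /\
  filterlim (fun t => Im (f t)) F (locally (Im z)).
Proof.
  split.
  - intros H; split; apply filterlim_locally; intros e;
      assert (He := proj1 (filterlim_locally f z) H e);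
      revert He; apply filter_imp; intros t [H1 H2]; assumption.
  - intros [H1 H2]. apply filterlim_locally. intros e.
    assert (He1 := proj1 (filterlim_locally _ _) H1 e).
    assert (He2 := proj1 (filterlim_locally _ _) H2 e).
    generalize (filter_and _ _ He1 He2). apply filter_imp.
    intros t [A B]; split; assumption.
Qed.

Section RealFilterlim.
Context {T : Type} (F : (T -> Prop) -> Prop) {FF : Filter F}.

Lemma filterlim_Rplus_fun (f g : T -> R) (x y : R) :
  filterlim f F (locally x) -> filterlim g F (locally y) ->
  filterlim (fun t => f t + g t) F (locally (x + y)).
Proof.
  intros Hf Hg.
  apply (filterlim_comp_2 (G := locally x) (H := locally y) f g Rplus Hf Hg).
  apply (filterlim_plus x y).
Qed.

Lemma filterlim_Rmult_fun (f g : T -> R) (x y : R) :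
  filterlim f F (locally x) -> filterlim g F (locally y) ->
  filterlim (fun t => f t * g t) F (locally (x * y)).
Proof.
  intros Hf Hg.
  apply (filterlim_comp_2 (G := locally x) (H := locally y) f g Rmult Hf Hg).
  apply (filterlim_mult x y).
Qed.

Lemma filterlim_Ropp_fun (f : T -> R) (x : R) :
  filterlim f F (locally x) -> filterlim (fun t => - f t) F (locally (- x)).
Proof.
  intros Hf. apply (filterlim_comp _ _ _ f Ropp F (locally x)); trivial.
  apply (filterlim_opp x).
Qed.

Lemma filterlim_Cplus (f g : T -> C) (x y : C) :
  filterlim f F (locally x) -> filterlim g F (locally y) ->
  filterlim (fun t => (f t + g t)%C) F (locally (x + y)%C).
Proof.
  intros Hf Hg. apply (filterlim_C _) in Hf. apply (filterlim_C _) in Hg.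
  apply (filterlim_C F); split; apply filterlim_Rplus_fun; tauto.
Qed.

Lemma filterlim_Cmult (f g : T -> C) (x y : C) :
  filterlim f F (locally x) -> filterlim g F (locally y) ->
  filterlim (fun t => (f t * g t)%C) F (locally (x * y)%C).
Proof.
  intros Hf Hg. apply (filterlim_C _) in Hf. apply (filterlim_C _) in Hg.
  apply (filterlim_C F); split.
  - apply filterlim_Rplus_fun; [|apply filterlim_Ropp_fun];
      apply filterlim_Rmult_fun; tauto.
  - apply filterlim_Rplus_fun; apply filterlim_Rmult_fun; tauto.
Qed.

Lemma filterlim_RtoC (f : T -> R) (x : R) :
  filterlim f F (locally x) -> filterlim (fun t => RtoC (f t)) F (locally (RtoC x)).
Proof.
  intros Hf. apply (filterlim_C F); split; trivial.
  apply filterlim_const.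
Qed.

Lemma filterlim_Cexpi (f : T -> R) (x : R) :
  filterlim f F (locally x) -> filterlim (fun t => Cexpi (f t)) F (locally (Cexpi x)).
Proof.
  intros Hf. apply (filterlim_C F); split.
  - apply (filterlim_comp _ _ _ f cos F (locally x)); trivial. apply continuous_cos.
  - apply (filterlim_comp _ _ _ f sin F (locally x)); trivial. apply continuous_sin.
Qed.

End RealFilterlim.

Lemma is_derive_C (f : R -> C) (t : R) (l : C) :
  is_derive f t l <->
  is_derive (fun s => Re (f s)) t (Re l) /\ is_derive (fun s => Im (f s)) t (Im l).
Proof.
  split.
  - intros H; split.
    + apply (filterdiff_comp' f (fun z : C => fst z) t (fun y => scal y l) fst H).
      apply filterdiff_linear, is_linear_fst.
    + apply (filterdiff_comp' f (fun z : C => snd z) t (fun y => scal y l) snd H).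
      apply filterdiff_linear, is_linear_snd.
  - intros [H1 H2].
    apply (is_derive_ext (fun s => plus (scal (Re (f s)) ((1, 0) : C_R_NormedModule))
                                      (scal (Im (f s)) ((0, 1) : C_R_NormedModule)))).
    + intros s. destruct (f s) as [a b]. unfold plus, scal; simpl.
      unfold prod_plus, prod_scal, plus, scal, mult; simpl. unfold mult; simpl. f_equal; ring.
    + replace l with (plus (scal (Re l) ((1, 0) : C_R_NormedModule))
                           (scal (Im l) ((0, 1) : C_R_NormedModule))).
      * refine (is_derive_plus _ _ _ _ _ _ _).
        -- exact (is_derive_scal_l (fun s => Re (f s)) t (Re l) _ H1).
        -- exact (is_derive_scal_l (fun s => Im (f s)) t (Im l) _ H2).
      * destruct l as [a b]. unfold plus, scal; simpl.
        unfold prod_plus, prod_scal, plus, scal, mult; simpl. unfold mult; simpl. f_equal; ring.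
Qed.

Lemma is_derive_Cplus (f g : R -> C) (t : R) (df dg : C) :
  is_derive f t df -> is_derive g t dg ->
  is_derive (fun s => (f s + g s)%C) t (df + dg)%C.
Proof. exact (is_derive_plus f g t df dg). Qed.

Lemma is_derive_Rmult (f g : R -> R) (t df dg : R) :
  is_derive f t df -> is_derive g t dg ->
  is_derive (fun s => f s * g s) t (df * g t + f t * dg).
Proof. intros Hf Hg. exact (is_derive_mult f g t df dg Hf Hg Rmult_comm). Qed.

Lemma is_derive_Cmult (f g : R -> C) (t : R) (df dg : C) :
  is_derive f t df -> is_derive g t dg ->
  is_derive (fun s => (f s * g s)%C) t (df * g t + f t * dg)%C.
Proof.
  intros Hf Hg. apply is_derive_C in Hf as [Hf1 Hf2]. apply is_derive_C in Hg as [Hg1 Hg2].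
  apply is_derive_C. split.
  - replace (Re (df * g t + f t * dg)%C) with
      ((Re df * Re (g t) + Re (f t) * Re dg) - (Im df * Im (g t) + Im (f t) * Im dg))
      by (simpl; unfold Re, Im; ring).
    exact (is_derive_minus _ _ _ _ _ (is_derive_Rmult _ _ _ _ _ Hf1 Hg1)
             (is_derive_Rmult _ _ _ _ _ Hf2 Hg2)).
  - replace (Im (df * g t + f t * dg)%C) with
      ((Re df * Im (g t) + Re (f t) * Im dg) + (Im df * Re (g t) + Im (f t) * Re dg))
      by (simpl; unfold Re, Im; ring).
    exact (is_derive_plus _ _ _ _ _ (is_derive_Rmult _ _ _ _ _ Hf1 Hg2)
             (is_derive_Rmult _ _ _ _ _ Hf2 Hg1)).
Qed.

Lemma is_derive_Cscal (c : C) (f : R -> C) (t : R) (df : C) :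
  is_derive f t df -> is_derive (fun s => (c * f s)%C) t (c * df)%C.
Proof.
  intros Hf.
  replace (c * df)%C with (RtoC 0 * f t + c * df)%C by ring.
  apply is_derive_Cmult; trivial. exact (is_derive_const (c : C_R_NormedModule) t).
Qed.

Lemma is_derive_Cexpi (g : R -> R) (t dg : R) :
  is_derive g t dg -> is_derive (fun s => Cexpi (g s)) t (Ci * dg * Cexpi (g t))%C.
Proof.
  intros Hg. apply is_derive_C; split.
  - replace (Re (Ci * dg * Cexpi (g t))%C) with (dg * - sin (g t)) by (simpl; ring).
    exact (is_derive_comp cos g t _ _ (is_derive_cos (g t)) Hg).
  - replace (Im (Ci * dg * Cexpi (g t))%C) with (dg * cos (g t)) by (simpl; ring).
    exact (is_derive_comp sin g t _ _ (is_derive_sin (g t)) Hg).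
Qed.

Lemma is_derive_C_comp (f : R -> C) (g : R -> R) (t : R) (df : C) (dg : R) :
  is_derive f (g t) df -> is_derive g t dg ->
  is_derive (fun s => f (g s)) t (dg * df)%C.
Proof.
  intros Hf Hg. rewrite <- scal_R_Cmult. exact (is_derive_comp f g t df dg Hf Hg).
Qed.

Lemma subdivision_ind (P : R -> R -> Prop) :
  (forall a b c, a <= b <= c -> P a b -> P b c -> P a c) ->
  forall (l : list R) (a b : R), a <= b ->
  (forall c d, a <= c -> c <= d -> d <= b ->
     (forall t, c < t < d -> ~ In t l) -> P c d) -> P a b.
Proof.
  intros Hch l. induction l as [|x l IH]; intros a b Hab H.
  - apply H; try lra. intros t _ [].
  - destruct (Rlt_dec a x) as [Hax|Hax]; [destruct (Rlt_dec x b) as [Hxb|Hxb]|].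
    + apply (Hch a x b); [lra| |]; (apply IH; [lra|]);
        intros c d H1 H2 H3 H4; apply H; try lra;
        intros t Ht [He|Hi]; try lra; exact (H4 t Ht Hi).
    + apply IH; [lra|]. intros c d H1 H2 H3 H4. apply H; try lra.
      intros t Ht [He|Hi]; try lra; exact (H4 t Ht Hi).
    + apply IH; [lra|]. intros c d H1 H2 H3 H4. apply H; try lra.
      intros t Ht [He|Hi]; try lra; exact (H4 t Ht Hi).
Qed.

Definition clamp (x : R) : R := Rmax 0 (Rmin 1 x).

Lemma clamp_in (x : R) : unit_interval (clamp x).
Proof. unfold clamp, unit_interval, Rmax, Rmin. repeat destruct Rle_dec; lra. Qed.

Lemma clamp_id (x : R) : unit_interval x -> clamp x = x.
Proof. unfold clamp, unit_interval, Rmax, Rmin. repeat destruct Rle_dec; lra. Qed.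

Lemma clamp_contract (x y : R) : Rabs (clamp x - clamp y) <= Rabs (x - y).
Proof.
  unfold clamp, Rmax, Rmin, Rabs.
  repeat destruct Rle_dec; repeat destruct Rcase_abs; lra.
Qed.

Lemma continuous_clamp {V : UniformSpace} (f : R -> V) :
  continuous_on unit_interval f -> forall x, continuous (fun t => f (clamp t)) x.
Proof.
  intros Hf x.
  apply (filterlim_comp _ _ _ clamp f (locally x) (within unit_interval (locally (clamp x)))).
  - intros P [e He]. exists e. intros y Hy. apply He; [|apply clamp_in].
    apply Rle_lt_trans with (2 := Hy). apply clamp_contract.
  - apply Hf, clamp_in.
Qed.

Lemma locally_unit (t : R) : 0 < t < 1 -> locally t (fun s => 0 < s < 1).
Proof. intros Ht. apply (open_and _ _ (open_gt 0) (open_lt 1) t Ht). Qed.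

Lemma continuous_on_interior {V : UniformSpace} (f : R -> V) (t : R) :
  continuous_on unit_interval f -> 0 < t < 1 -> continuous f t.
Proof.
  intros Hf Ht. apply (continuous_continuous_on unit_interval); trivial.
  apply filter_imp with (2 := locally_unit t Ht). intros s Hs; unfold unit_interval; lra.
Qed.

Lemma nondecreasing_of_derive (f df : R -> R) (l : list R) :
  continuous_on unit_interval f ->
  (forall t, 0 < t < 1 -> ~ In t l -> is_derive f t (df t) /\ 0 <= df t) ->
  f 0 <= f 1.
Proof.
  intros Hc Hd.
  enough (f (clamp 0) <= f (clamp 1)) by
    (rewrite 2!clamp_id in H by (unfold unit_interval; lra); exact H).
  apply (subdivision_ind (fun a b => f (clamp a) <= f (clamp b))) with (l := l); [intros; lra|lra|].
  intros a b Ha Hab Hb Hl.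
  assert (Hd' : forall t : R, a < t < b -> is_derive (fun t => f (clamp t)) t (df t)).
  { intros t Ht. assert (Ht1 : 0 < t < 1) by lra. apply (is_derive_ext_loc f).
    - apply filter_imp with (2 := locally_unit t Ht1).
      intros s Hs. rewrite clamp_id; trivial. unfold unit_interval; lra.
    - apply Hd; [lra|]. apply Hl, Ht. }
  destruct (Req_dec a b) as [->|Hne]; [lra|].
  destruct (MVT_gen (fun t => f (clamp t)) a b (fun t => Rmax 0 (df t))) as (c & Hc1 & Hc2).
  - rewrite Rmin_left, Rmax_right by lra. intros t Ht. rewrite Rmax_right; [auto|].
    apply Hd; [lra|]. apply Hl, Ht.
  - intros t _. apply continuity_pt_filterlim, (continuous_clamp f Hc).
  - generalize (Rmax_l 0 (df c)). nra.
Qed.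

Lemma constant_of_derive (f : R -> R) (l : list R) :
  continuous_on unit_interval f ->
  (forall t, 0 < t < 1 -> ~ In t l -> is_derive f t 0) -> f 0 = f 1.
Proof.
  intros Hc Hd. apply Rle_antisym.
  - apply (nondecreasing_of_derive f (fun _ => 0) l); auto with real.
  - apply Ropp_le_cancel.
    apply (nondecreasing_of_derive (fun t => - f t) (fun _ => - 0) l).
    + intros t Ht. apply (filterlim_Ropp_fun _ f), Hc, Ht.
    + intros t Ht Hi. split; [|lra]. apply (is_derive_opp f); auto.
Qed.

Lemma locally_not_in (l : list R) (t0 : R) :
  locally t0 (fun t => t <> t0 -> ~ In t l).
Proof.
  induction l as [|x l IH].
  - apply filter_forall. intros t _ [].
  - assert (H : locally t0 (fun t => t <> t0 -> t <> x)).
    { destruct (Req_dec x t0) as [->|Hn].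
      - apply filter_forall. auto.
      - assert (Hp : 0 < Rabs (x - t0)) by (apply Rabs_pos_lt; lra).
        exists (mkposreal _ Hp). intros t Ht _ ->. apply (Rlt_irrefl _ Ht). }
    generalize (filter_and _ _ H IH). apply filter_imp.
    intros t [H1 H2] Hn [He|Hi]; [apply (H1 Hn); auto|apply (H2 Hn Hi)].
Qed.

(* A mean value argument: near [t0] the difference quotients at [t0] are values
   of [h] at intermediate points. *)
Lemma is_derive_removable (f h : R -> R) (l : list R) (t0 : R) :
  (forall t, 0 < t < 1 -> continuous f t) ->
  (forall t, 0 < t < 1 -> ~ In t l -> is_derive f t (h t)) ->
  0 < t0 < 1 -> continuous h t0 -> is_derive f t0 (h t0).
Proof.
  intros Hc Hd Ht0 Hh. apply is_derive_Reals. intros e He.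
  assert (Hl : locally t0 (fun t => (0 < t < 1 /\ (t <> t0 -> ~ In t l)) /\
                                     Rabs (h t - h t0) < e)).
  { apply filter_and.
    - apply filter_and; [apply locally_unit, Ht0 | apply locally_not_in].
    - exact (proj1 (filterlim_locally _ _) Hh (mkposreal e He)). }
  destruct Hl as [d Hl]. exists d. intros s Hs Hsd.
  assert (Hin : forall t, Rmin t0 (t0 + s) <= t <= Rmax t0 (t0 + s) ->
            (0 < t < 1 /\ (t <> t0 -> ~ In t l)) /\ Rabs (h t - h t0) < e).
  { intros t Ht. apply Hl. unfold ball; simpl; unfold AbsRing_ball, abs, minus, plus, opp; simpl.
    apply Rle_lt_trans with (2 := Hsd). revert Ht. unfold Rmin, Rmax, Rabs.
    repeat destruct Rle_dec; repeat destruct Rcase_abs; lra. }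
  destruct (MVT_gen f t0 (t0 + s) h) as (c & Hc1 & Hc2).
  - intros t Ht. destruct (Hin t) as [[H1 H2] _]; [lra|]. apply Hd; trivial. apply H2.
    revert Ht. unfold Rmin, Rmax. repeat destruct Rle_dec; lra.
  - intros t Ht. apply continuity_pt_filterlim, Hc, (Hin t Ht).
  - rewrite Hc2. replace (h c * (t0 + s - t0) / s - h t0) with (h c - h t0) by (field; trivial).
    apply Hin, Hc1.
Qed.

Lemma is_derive_C_removable (f h : R -> C) (l : list R) (t0 : R) :
  (forall t, 0 < t < 1 -> continuous f t) ->
  (forall t, 0 < t < 1 -> ~ In t l -> is_derive f t (h t)) ->
  0 < t0 < 1 -> continuous h t0 -> is_derive f t0 (h t0).
Proof.
  intros Hc Hd Ht0 Hh. apply (filterlim_C _) in Hh.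
  apply is_derive_C; split.
  - apply (is_derive_removable (fun t => Re (f t)) (fun t => Re (h t)) l); trivial.
    + intros t Ht. specialize (Hc t Ht). apply (filterlim_C _) in Hc; apply Hc.
    + intros t Ht Hi. specialize (Hd t Ht Hi). apply is_derive_C in Hd. apply Hd.
    + apply Hh.
  - apply (is_derive_removable (fun t => Im (f t)) (fun t => Im (h t)) l); trivial.
    + intros t Ht. specialize (Hc t Ht). apply (filterlim_C _) in Hc; apply Hc.
    + intros t Ht Hi. specialize (Hd t Ht Hi). apply is_derive_C in Hd. apply Hd.
    + apply Hh.
Qed.

Lemma ex_RInt_piecewise (f : R -> R) :
  piecewise_continuous f -> forall a b, 0 <= a <= b -> b <= 1 -> ex_RInt f a b.
Proof.
  intros ([l Hl] & Hr & Hlft) a b Hab Hb.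
  apply (subdivision_ind (ex_RInt f)) with (l := l); try lra.
  - intros x y z _. apply ex_RInt_Chasles.
  - intros c d Hc Hcd Hd Hin.
    destruct (Req_dec c d) as [<-|Hne]; [apply ex_RInt_point|].
    destruct (Hr c ltac:(lra)) as [la Hla]. destruct (Hlft d ltac:(lra)) as [lb Hlb].
    destruct (C0_extension_lt f la lb c d) as (g & Hg & Hfg & _); trivial; try lra.
    { intros t Ht. apply Hl; [lra|]. apply Hin, Ht. }
    apply (ex_RInt_ext g).
    + rewrite Rmin_left, Rmax_right by lra. intros x Hx; apply Hfg; lra.
    + apply (ex_RInt_continuous g). intros z _. apply Hg.
Qed.

Lemma piecewise_continuous_comp (g f : R -> R) :
  (forall x, continuous g x) -> piecewise_continuous f ->
  piecewise_continuous (fun t => g (f t)).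
Proof.
  intros Hg ([l Hl] & Hr & Hlft). split; [|split].
  - exists l. intros t Ht Hi. apply continuous_comp; auto.
  - intros t Ht. destruct (Hr t Ht) as [y Hy]. exists (g y).
    apply (filterlim_comp _ _ _ f g _ (locally y)); trivial. apply Hg.
  - intros t Ht. destruct (Hlft t Ht) as [y Hy]. exists (g y).
    apply (filterlim_comp _ _ _ f g _ (locally y)); trivial. apply Hg.
Qed.

Lemma is_derive_primitive (f : R -> R) (t : R) :
  (forall a b, 0 <= a <= b -> b <= 1 -> ex_RInt f a b) ->
  0 < t < 1 -> continuous f t -> is_derive (fun s => RInt f 0 s) t (f t).
Proof.
  intros Hf Ht Hc. apply (is_derive_RInt f (fun s => RInt f 0 s) 0); trivial.
  apply filter_imp with (2 := locally_unit t Ht).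
  intros s Hs. apply (RInt_correct (V := R_CompleteNormedModule)), Hf; lra.
Qed.

Lemma lipschitz_continuous_on (f : R -> R) (K : R) :
  (forall s t, unit_interval s -> unit_interval t -> s <= t ->
     Rabs (f t - f s) <= K * (t - s)) ->
  continuous_on unit_interval f.
Proof.
  intros HK t Ht. apply filterlim_locally. intros e.
  assert (Hp : 0 < e / (Rabs K + 1)).
  { apply Rdiv_lt_0_compat; [apply e|]. generalize (Rabs_pos K); lra. }
  exists (mkposreal _ Hp). intros s Hs Hsu.
  unfold ball in *; simpl in *; unfold AbsRing_ball, abs, minus, plus, opp in *; simpl in *.
  change (s + - t) with (s - t) in Hs. change (f s + - f t) with (f s - f t).
  assert (H1 : Rabs (f s - f t) <= Rabs K * Rabs (s - t)).
  { rewrite <- Rabs_mult. destruct (Rle_dec s t) as [H|H].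
    - rewrite Rabs_minus_sym. apply Rle_trans with (1 := HK s t Hsu Ht H).
      rewrite Rabs_mult, (Rabs_minus_sym s t), <- Rabs_mult. apply Rle_abs.
    - apply Rle_trans with (1 := HK t s Ht Hsu ltac:(lra)). apply Rle_abs. }
  apply Rle_lt_trans with (1 := H1).
  generalize (Rabs_pos K) (Rabs_pos (s - t)); intros HK0 Hs0.
  apply Rlt_div_r in Hs; [|lra]. nra.
Qed.

Lemma lipschitz_primitive (f : R -> R) (M : R) :
  (forall a b, 0 <= a <= b -> b <= 1 -> ex_RInt f a b) ->
  (forall t, Rabs (f t) <= M) ->
  forall s t, unit_interval s -> unit_interval t -> s <= t ->
     Rabs (RInt f 0 t - RInt f 0 s) <= M * (t - s).
Proof.
  intros Hf HM s t Hs Ht Hst. unfold unit_interval in *.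
  replace (RInt f 0 t - RInt f 0 s) with (RInt f s t).
  - rewrite Rmult_comm. apply abs_RInt_le_const; auto. apply Hf; lra.
  - assert (H := RInt_Chasles (V := R_CompleteNormedModule) f 0 s t
                   (Hf 0 s ltac:(lra) ltac:(lra)) (Hf s t ltac:(lra) ltac:(lra))).
    unfold plus in H; simpl in H. lra.
Qed.

(** * Two-component systems with real coefficients *)

Lemma is_derive_eq {V : NormedModule R_AbsRing} (f : R -> V) (t : R) (l l' : V) :
  is_derive f t l -> l = l' -> is_derive f t l'.
Proof. now intros H <-. Qed.

Lemma is_derive_C_eq (f : R -> C) (t : R) (l l' : C) :
  is_derive f t l -> l = l' -> is_derive f t l'.
Proof. now intros H <-. Qed.

Definition system_at (d p q : R -> R) (u v : R -> C) (t : R) : Prop :=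
  is_derive u t (Ci * (d t * u t + p t * v t))%C /\
  is_derive v t (Ci * (q t * u t + d t * v t))%C.

(* Differential equations are only imposed off some finite set; at a point where
   the coefficients are continuous they then hold automatically
   (lemma [solution_regular]). *)
Definition solution (d p q : R -> R) (u v : R -> C) : Prop :=
  continuous_on unit_interval u /\ continuous_on unit_interval v /\
  exists l : list R, forall t, 0 < t < 1 -> ~ In t l -> system_at d p q u v t.

Definition scatters (d p q : R -> R) (I0 T R0 : C) : Prop :=
  exists u v : R -> C, solution d p q u v /\
    u 0 = (I0 - R0)%C /\ v 0 = (I0 + R0)%C /\ u 1 = T /\ v 1 = T.

Lemma solution_regular (d p q : R -> R) (u v : R -> C) (t : R) :
  solution d p q u v -> 0 < t < 1 ->
  continuous d t -> continuous p t -> continuous q t -> system_at d p q u v t.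
Proof.
  intros (Hu & Hv & l & Hl) Ht Hd Hp Hq.
  assert (Hut := continuous_on_interior u t Hu Ht).
  assert (Hvt := continuous_on_interior v t Hv Ht).
  split.
  - apply (is_derive_C_removable u (fun t => Ci * (d t * u t + p t * v t))%C l); trivial.
    + intros s Hs. apply continuous_on_interior; trivial.
    + intros s Hs Hi. apply Hl; trivial.
    + apply filterlim_Cmult; [typeclasses eauto|apply filterlim_const|].
      apply filterlim_Cplus; [typeclasses eauto| |];
        (apply filterlim_Cmult; [typeclasses eauto| |]; trivial);
        apply filterlim_RtoC; trivial; typeclasses eauto.
  - apply (is_derive_C_removable v (fun t => Ci * (q t * u t + d t * v t))%C l); trivial.
    + intros s Hs. apply continuous_on_interior; trivial.
    + intros s Hs Hi. apply Hl; trivial.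
    + apply filterlim_Cmult; [typeclasses eauto|apply filterlim_const|].
      apply filterlim_Cplus; [typeclasses eauto| |];
        (apply filterlim_Cmult; [typeclasses eauto| |]; trivial);
        apply filterlim_RtoC; trivial; typeclasses eauto.
Qed.

Lemma continuous_on_Re (u : R -> C) :
  continuous_on unit_interval u -> continuous_on unit_interval (fun t => Re (u t)).
Proof. intros H t Ht. specialize (H t Ht). apply (filterlim_C _) in H. apply H. Qed.

Lemma continuous_on_Im (u : R -> C) :
  continuous_on unit_interval u -> continuous_on unit_interval (fun t => Im (u t)).
Proof. intros H t Ht. specialize (H t Ht). apply (filterlim_C _) in H. apply H. Qed.

Lemma continuous_on_Rplus (f g : R -> R) :
  continuous_on unit_interval f -> continuous_on unit_interval g ->
  continuous_on unit_interval (fun t => f t + g t).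
Proof. intros Hf Hg t Ht. apply (filterlim_Rplus_fun _); auto. Qed.

Lemma continuous_on_Rmult (f g : R -> R) :
  continuous_on unit_interval f -> continuous_on unit_interval g ->
  continuous_on unit_interval (fun t => f t * g t).
Proof. intros Hf Hg t Ht. apply (filterlim_Rmult_fun _); auto. Qed.

Lemma continuous_on_Cmult (f g : R -> C) :
  continuous_on unit_interval f -> continuous_on unit_interval g ->
  continuous_on unit_interval (fun t => (f t * g t)%C).
Proof. intros Hf Hg t Ht. apply (filterlim_Cmult _); auto. Qed.

Lemma continuous_on_Cplus (f g : R -> C) :
  continuous_on unit_interval f -> continuous_on unit_interval g ->
  continuous_on unit_interval (fun t => (f t + g t)%C).
Proof. intros Hf Hg t Ht. apply (filterlim_Cplus _); auto. Qed.

Lemma continuous_on_const_C (c : C) :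
  continuous_on unit_interval (fun _ : R => c).
Proof. intros t Ht. apply filterlim_const. Qed.

Lemma system_at_components (d p q : R -> R) (u v : R -> C) (t : R) :
  system_at d p q u v t ->
  is_derive (fun s => Re (u s)) t (- (d t * Im (u t) + p t * Im (v t))) /\
  is_derive (fun s => Im (u s)) t (d t * Re (u t) + p t * Re (v t)) /\
  is_derive (fun s => Re (v s)) t (- (q t * Im (u t) + d t * Im (v t))) /\
  is_derive (fun s => Im (v s)) t (q t * Re (u t) + d t * Re (v t)).
Proof.
  intros [Hu Hv]. apply is_derive_C in Hu as [H1 H2]. apply is_derive_C in Hv as [H3 H4].
  split; [|split; [|split]].
  - eapply is_derive_eq; [exact H1|]. unfold Re, Im; simpl; ring.
  - eapply is_derive_eq; [exact H2|]. unfold Re, Im; simpl; ring.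
  - eapply is_derive_eq; [exact H3|]. unfold Re, Im; simpl; ring.
  - eapply is_derive_eq; [exact H4|]. unfold Re, Im; simpl; ring.
Qed.

(* Conservation of the energy flux [Re (u * Cconj v)], because [d], [p], [q] are real. *)
Lemma flux_conserved (d p q : R -> R) (u v : R -> C) :
  solution d p q u v ->
  Re (u 0) * Re (v 0) + Im (u 0) * Im (v 0) = Re (u 1) * Re (v 1) + Im (u 1) * Im (v 1).
Proof.
  intros (Hu & Hv & l & Hl).
  apply (constant_of_derive (fun t => Re (u t) * Re (v t) + Im (u t) * Im (v t)) l).
  - apply continuous_on_Rplus; apply continuous_on_Rmult;
      auto using continuous_on_Re, continuous_on_Im.
  - intros t Ht Hi.
    destruct (system_at_components _ _ _ _ _ _ (Hl t Ht Hi)) as (H1 & H2 & H3 & H4).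
    assert (H := is_derive_plus _ _ _ _ _ (is_derive_Rmult _ _ _ _ _ H1 H3)
                   (is_derive_Rmult _ _ _ _ _ H2 H4)).
    eapply is_derive_eq; [exact H|]. unfold plus; simpl; ring.
Qed.

(* Gronwall's argument for the squared norm. *)
Lemma solution_zero (d p q : R -> R) (K : R) (u v : R -> C) :
  (forall t, Rabs (p t - q t) <= K) ->
  solution d p q u v -> u 1 = 0 -> v 1 = 0 -> u 0 = 0 /\ v 0 = 0.
Proof.
  intros HK (Hu & Hv & l & Hl) Hu1 Hv1.
  set (E := fun t => (Re (u t) * Re (u t) + Im (u t) * Im (u t)) +
                     (Re (v t) * Re (v t) + Im (v t) * Im (v t))).
  assert (HE : exp (K * 0) * E 0 <= exp (K * 1) * E 1).
  { apply (nondecreasing_of_derive (fun t => exp (K * t) * E t)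
      (fun t => K * exp (K * t) * E t + exp (K * t) *
         (2 * (p t - q t) * (Im (u t) * Re (v t) - Re (u t) * Im (v t)))) l).
    - apply continuous_on_Rmult.
      + apply continuous_on_forall. intros t _. apply (ex_derive_continuous (V := R_NormedModule)).
        auto_derive; trivial.
      + repeat apply continuous_on_Rplus; apply continuous_on_Rmult;
          auto using continuous_on_Re, continuous_on_Im.
    - intros t Ht Hi.
      destruct (system_at_components _ _ _ _ _ _ (Hl t Ht Hi)) as (H1 & H2 & H3 & H4).
      split.
      + apply (is_derive_Rmult (fun t => exp (K * t)) E); [auto_derive; trivial; ring|].
        assert (H := is_derive_plus _ _ _ _ _
          (is_derive_plus _ _ _ _ _ (is_derive_Rmult _ _ _ _ _ H1 H1)
             (is_derive_Rmult _ _ _ _ _ H2 H2))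
          (is_derive_plus _ _ _ _ _ (is_derive_Rmult _ _ _ _ _ H3 H3)
             (is_derive_Rmult _ _ _ _ _ H4 H4))).
        eapply is_derive_eq; [exact H|]. unfold plus; simpl; ring.
      + replace (K * exp (K * t) * E t + _) with
          (exp (K * t) * (K * E t +
             2 * (p t - q t) * (Im (u t) * Re (v t) - Re (u t) * Im (v t)))) by ring.
        apply Rmult_le_pos; [left; apply exp_pos|].
        specialize (HK t). apply Rabs_le_between in HK. unfold E.
        generalize (Re (u t)) (Im (u t)) (Re (v t)) (Im (v t)) HK. intros a b c e.
        generalize (p t - q t). intros r Hr.
        assert (H5 : -(a*a+b*b+c*c+e*e) <= 2 * (b*c - a*e) <= a*a+b*b+c*c+e*e).
        { generalize (pow2_ge_0 (b-c)) (pow2_ge_0 (a+e)) (pow2_ge_0 (b+c)) (pow2_ge_0 (a-e)).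
          simpl. lra. }
        nra. }
  assert (H1 : E 1 = 0) by (unfold E; rewrite Hu1, Hv1; simpl; ring).
  rewrite H1, !Rmult_0_r, exp_0 in HE.
  unfold E, Re, Im in HE.
  split; apply injective_projections; simpl; nra.
Qed.

Lemma scatters_flux (d p q : R -> R) (I0 T R0 : C) :
  scatters d p q I0 T R0 -> Cmod T ^ 2 + Cmod R0 ^ 2 = Cmod I0 ^ 2.
Proof.
  intros (u & v & H & H1 & H2 & H3 & H4). apply flux_conserved in H.
  rewrite H1, H2, H3, H4 in H. unfold Cmod. rewrite !pow2_sqrt by nra.
  unfold Re, Im in H; simpl in *. lra.
Qed.

Lemma scatters_linear (d p q : R -> R) (c I0 T R0 c' I0' T' R0' : C) :
  scatters d p q I0 T R0 -> scatters d p q I0' T' R0' ->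
  scatters d p q (c * I0 + c' * I0') (c * T + c' * T') (c * R0 + c' * R0').
Proof.
  intros (u & v & (Hu & Hv & l & Hl) & H1 & H2 & H3 & H4).
  intros (u' & v' & (Hu' & Hv' & l' & Hl') & H1' & H2' & H3' & H4').
  exists (fun t => c * u t + c' * u' t)%C, (fun t => c * v t + c' * v' t)%C.
  rewrite H1, H2, H3, H4, H1', H2', H3', H4'.
  split; [|split; [ring|split; [ring|split; ring]]].
  split; [|split].
  - apply continuous_on_Cplus; apply continuous_on_Cmult; trivial; apply continuous_on_const_C.
  - apply continuous_on_Cplus; apply continuous_on_Cmult; trivial; apply continuous_on_const_C.
  - exists (l ++ l'). intros t Ht Hi.
    destruct (Hl t Ht) as [D1 D2]; [intros Hi'; apply Hi, in_or_app; auto|].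
    destruct (Hl' t Ht) as [D1' D2']; [intros Hi'; apply Hi, in_or_app; auto|].
    split.
    + eapply is_derive_C_eq; [exact (is_derive_Cplus _ _ _ _ _ (is_derive_Cscal c _ _ _ D1)
                                (is_derive_Cscal c' _ _ _ D1'))|]. ring.
    + eapply is_derive_C_eq; [exact (is_derive_Cplus _ _ _ _ _ (is_derive_Cscal c _ _ _ D2)
                                (is_derive_Cscal c' _ _ _ D2'))|]. ring.
Qed.

Lemma scatters_unique (d p q : R -> R) (I0 T R0 T' R0' : C) :
  scatters d p q I0 T R0 -> scatters d p q I0 T' R0' -> T = T' /\ R0 = R0'.
Proof.
  intros H H'.
  assert (HF := scatters_flux _ _ _ _ _ _ (scatters_linear _ _ _ 1 _ _ _ (- (1)) _ _ _ H H')).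
  replace (1 * I0 + - (1) * I0)%C with (RtoC 0) in HF by ring.
  rewrite Cmod_0 in HF.
  generalize (pow2_ge_0 (Cmod (1 * T + - (1) * T'))) (pow2_ge_0 (Cmod (1 * R0 + - (1) * R0'))).
  intros HT HR.
  assert (HT0 : (1 * T + - (1) * T' = 0)%C) by (apply Cmod_eq_0; nra).
  assert (HR0 : (1 * R0 + - (1) * R0' = 0)%C) by (apply Cmod_eq_0; nra).
  split.
  - replace T with ((1 * T + - (1) * T') + T')%C by ring. rewrite HT0; ring.
  - replace R0 with ((1 * R0 + - (1) * R0') + R0')%C by ring. rewrite HR0; ring.
Qed.

Lemma scatters_scal (d p q : R -> R) (c I0 T R0 : C) :
  scatters d p q I0 T R0 -> scatters d p q (c * I0) (c * T) (c * R0).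
Proof.
  intros H. generalize (scatters_linear _ _ _ c _ _ _ 0 _ _ _ H H).
  now rewrite !Cmult_0_l, !Cplus_0_r.
Qed.

Lemma scatters_0 (d p q : R -> R) : scatters d p q 0 0 0.
Proof.
  exists (fun _ => RtoC 0), (fun _ => RtoC 0).
  split; [|split; [ring|split; [ring|split; reflexivity]]].
  split; [|split]; try apply continuous_on_const_C.
  exists nil. intros t _ _. split.
  - rewrite !Cmult_0_r, Cplus_0_r, Cmult_0_r. exact (is_derive_const (RtoC 0 : C_R_NormedModule) t).
  - rewrite !Cmult_0_r, Cplus_0_r, Cmult_0_r. exact (is_derive_const (RtoC 0 : C_R_NormedModule) t).
Qed.

Lemma scatters_T_neq_0 (d p q : R -> R) (K : R) (I0 T R0 : C) :
  (forall t, Rabs (p t - q t) <= K) ->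
  scatters d p q I0 T R0 -> I0 <> 0 -> T <> 0.
Proof.
  intros HK (u & v & H & H1 & H2 & H3 & H4) HI HT. apply HI.
  rewrite HT in H3, H4.
  destruct (solution_zero _ _ _ _ _ _ HK H H3 H4) as [Hu Hv].
  rewrite H1 in Hu. rewrite H2 in Hv.
  replace I0 with (/ RtoC 2 * ((I0 - R0) + (I0 + R0)))%C by (field; intros E; injection E; lra).
  rewrite Hu, Hv. ring.
Qed.

Lemma scatters_ext (d p q d' p' q' : R -> R) (I0 T R0 : C) :
  (forall t, 0 < t < 1 -> d t = d' t /\ p t = p' t /\ q t = q' t) ->
  scatters d p q I0 T R0 -> scatters d' p' q' I0 T R0.
Proof.
  intros Heq (u & v & (Hu & Hv & l & Hl) & H). exists u, v. split; trivial.
  split; [|split]; trivial. exists l. intros t Ht Hi.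
  destruct (Heq t Ht) as (E1 & E2 & E3). destruct (Hl t Ht Hi) as [D1 D2].
  split; [rewrite <- E1, <- E2 | rewrite <- E1, <- E3]; trivial.
Qed.

Lemma Cexpi_0 : Cexpi 0 = 1.
Proof. unfold Cexpi. rewrite cos_0, sin_0. reflexivity. Qed.

Lemma scatters_gauge (d p q G g : R -> R) (I0 T R0 : C) :
  continuous_on unit_interval G -> G 0 = 0 ->
  (exists l : list R, forall t, 0 < t < 1 -> ~ In t l -> is_derive G t (g t)) ->
  scatters d p q I0 T R0 ->
  scatters (fun t => d t + g t) p q I0 (T * Cexpi (G 1)) R0.
Proof.
  intros HG HG0 [l' Hl'] (u & v & (Hu & Hv & l & Hl) & H1 & H2 & H3 & H4).
  exists (fun t => u t * Cexpi (G t))%C, (fun t => v t * Cexpi (G t))%C.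
  rewrite H1, H2, H3, H4, HG0, Cexpi_0.
  split; [|split; [ring|split; [ring|split; ring]]].
  assert (HE : continuous_on unit_interval (fun t => Cexpi (G t))).
  { intros t Ht. apply (filterlim_Cexpi _). auto. }
  split; [|split].
  - apply continuous_on_Cmult; trivial.
  - apply continuous_on_Cmult; trivial.
  - exists (l ++ l'). intros t Ht Hi.
    destruct (Hl t Ht) as [D1 D2]; [intros Hi'; apply Hi, in_or_app; auto|].
    assert (D : is_derive G t (g t)) by (apply Hl'; trivial; intros Hi'; apply Hi, in_or_app; auto).
    apply is_derive_Cexpi in D. split.
    + eapply is_derive_C_eq; [exact (is_derive_Cmult _ _ _ _ _ D1 D)|].
      rewrite RtoC_plus. ring.
    + eapply is_derive_C_eq; [exact (is_derive_Cmult _ _ _ _ _ D2 D)|].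
      rewrite RtoC_plus. ring.
Qed.

Lemma scatters_time_change (d p q sigma dsigma rho : R -> R) (I0 T R0 : C) :
  continuous_on unit_interval sigma -> sigma 0 = 0 -> sigma 1 = 1 ->
  (forall t, unit_interval t -> unit_interval (sigma t)) ->
  (forall t, 0 < t < 1 -> 0 < sigma t < 1 /\ rho (sigma t) = t) ->
  (exists l : list R, forall t, 0 < t < 1 -> ~ In t l -> is_derive sigma t (dsigma t)) ->
  scatters d p q I0 T R0 ->
  scatters (fun t => dsigma t * d (sigma t)) (fun t => dsigma t * p (sigma t))
           (fun t => dsigma t * q (sigma t)) I0 T R0.
Proof.
  intros Hs Hs0 Hs1 Hsu Hrho [l' Hl'] (u & v & (Hu & Hv & l & Hl) & H1 & H2 & H3 & H4).
  exists (fun t => u (sigma t)), (fun t => v (sigma t)).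
  rewrite Hs0, Hs1. split; [|tauto].
  assert (Hc : forall w : R -> C, continuous_on unit_interval w ->
                 continuous_on unit_interval (fun t => w (sigma t))).
  { intros w Hw t Ht.
    apply (filterlim_comp _ _ _ sigma w _ (within unit_interval (locally (sigma t)))).
    - intros P HP. specialize (Hs t Ht _ HP). unfold filtermap, within in *.
      revert Hs. apply filter_imp. auto.
    - apply Hw, Hsu, Ht. }
  split; [|split]; auto.
  exists (l' ++ map rho l). intros t Ht Hi.
  assert (D : is_derive sigma t (dsigma t))
    by (apply Hl'; trivial; intros Hi'; apply Hi, in_or_app; auto).
  destruct (Hrho t Ht) as [Hst Hr].
  destruct (Hl (sigma t) Hst) as [D1 D2].
  { intros Hi'. apply Hi, in_or_app. right. rewrite <- Hr. apply in_map, Hi'. }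
  split.
  - eapply is_derive_C_eq; [exact (is_derive_C_comp _ _ _ _ _ D1 D)|].
    rewrite !RtoC_mult. ring.
  - eapply is_derive_C_eq; [exact (is_derive_C_comp _ _ _ _ _ D2 D)|].
    rewrite !RtoC_mult. ring.
Qed.

Lemma the_unique {A : Type} (d : A) (P : A -> Prop) (x : A) :
  P x -> (forall y, P y -> y = x) -> the d P = x.
Proof.
  intros Hx Hu. unfold the. destruct excluded_middle_informative as [h|h].
  - apply Hu. destruct constructive_indefinite_description; trivial.
  - exfalso; eauto.
Qed.

Lemma the_none {A : Type} (d : A) (P : A -> Prop) :
  (forall x, ~ P x) -> the d P = d.
Proof.
  intros H. unfold the. destruct excluded_middle_informative as [[x Hx]|h]; trivial.
  destruct (H x Hx).
Qed.

Lemma oscillator (k : R) :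
  exists c s : R -> R,
    (forall t, is_derive c t (- k * s t)) /\ (forall t, is_derive s t (c t)) /\
    c 0 = 1 /\ s 0 = 0 /\ forall t, c t ^ 2 + k * s t ^ 2 = 1.
Proof.
  destruct (total_order_T k 0) as [[Hk|Hk]|Hk].
  - set (w := sqrt (- k)).
    assert (Hw : 0 < w) by (apply sqrt_lt_R0; lra).
    assert (Hkw : k = - (w * w)) by (unfold w; rewrite sqrt_sqrt; lra).
    exists (fun t => (exp (w * t) + exp (- (w * t))) / 2),
           (fun t => (exp (w * t) - exp (- (w * t))) / (2 * w)).
    rewrite Hkw. repeat apply conj.
    + intros t. auto_derive; trivial. field; lra.
    + intros t. auto_derive; trivial. field; lra.
    + rewrite Rmult_0_r, Ropp_0, exp_0. field.
    + rewrite Rmult_0_r, Ropp_0, exp_0. field; lra.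
    + intros t. rewrite exp_Ropp. generalize (exp_pos (w * t)); intros He. field; lra.
  - exists (fun _ => 1), (fun t => t). subst k. repeat apply conj; trivial.
    + intros t. auto_derive; trivial. ring.
    + intros t. auto_derive; trivial.
    + intros t. ring.
  - set (w := sqrt k).
    assert (Hw : 0 < w) by (apply sqrt_lt_R0; lra).
    assert (Hkw : k = w * w) by (unfold w; rewrite sqrt_sqrt; lra).
    exists (fun t => cos (w * t)), (fun t => sin (w * t) / w).
    rewrite Hkw. repeat apply conj.
    + intros t. auto_derive; trivial. field; lra.
    + intros t. auto_derive; trivial. field; lra.
    + rewrite Rmult_0_r. apply cos_0.
    + rewrite Rmult_0_r, sin_0. field; lra.
    + intros t. replace (w * w * (sin (w * t) / w) ^ 2) with (Rsqr (sin (w * t)))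
        by (unfold Rsqr; field; lra).
      generalize (sin2_cos2 (w * t)). unfold Rsqr. lra.
Qed.

Lemma scatters_constant (a b : R) :
  exists T R0 : C, T <> 0 /\
    scatters (fun _ => 0) (fun _ => a) (fun _ => b) 1 T R0.
Proof.
  destruct (oscillator (a * b)) as (c & s & Hc & Hs & Hc0 & Hs0 & Hcs).
  set (D := (RtoC (c 1) - Ci * RtoC ((a + b) / 2 * s 1))%C).
  assert (HD : D <> 0).
  { intros E. injection E. intros E1 E2. generalize (Hcs 1). simpl in E1, E2.
    assert (H1 : (a + b) * s 1 = 0) by lra. assert (H2 : c 1 = 0) by lra. rewrite H2.
    intros H3. destruct (Rmult_integral _ _ H1) as [H4|H4].
    - replace b with (- a) in H3 by lra. nra.
    - rewrite H4 in H3. lra. }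
  assert (Hcd : forall t : R,
    is_derive (fun t : R => RtoC (c (1 - t))) t (RtoC (a * b * s (1 - t)))).
  { intros t. apply is_derive_C; split; [|exact (is_derive_const 0 t)].
    eapply is_derive_eq; [refine (is_derive_comp c (fun t => 1 - t) t _ (-1) (Hc _) _)|].
    - auto_derive; trivial; ring.
    - unfold scal; simpl; unfold mult; simpl; ring. }
  assert (Hsd : forall t : R,
    is_derive (fun t : R => RtoC (s (1 - t))) t (RtoC (- c (1 - t)))).
  { intros t. apply is_derive_C; split; [|exact (is_derive_const 0 t)].
    eapply is_derive_eq; [refine (is_derive_comp s (fun t => 1 - t) t _ (-1) (Hs _) _)|].
    - auto_derive; trivial; ring.
    - unfold scal; simpl; unfold mult; simpl; ring. }
  assert (Hd : forall x t : R,
     is_derive (fun t : R => RtoC (c (1 - t)%R) + (- Ci * x) * RtoC (s (1 - t)%R))%C t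
       (RtoC ((a * b * s (1 - t))%R) + (- Ci * x) * RtoC ((- c (1 - t))%R))%C).
  { intros x t. apply is_derive_Cplus; [apply Hcd|]. apply is_derive_Cscal, Hsd. }
  assert (Hcont : forall x : R, continuous_on unit_interval
     (fun t : R => RtoC (c (1 - t)%R) + (- Ci * x) * RtoC (s (1 - t)%R))%C).
  { intros x. apply continuous_on_forall. intros t _.
    apply (ex_derive_continuous (V := C_R_NormedModule)). eexists. apply Hd. }
  assert (H : scatters (fun _ => 0) (fun _ => a) (fun _ => b) D 1
                (Ci * RtoC ((a - b) / 2 * s 1)%R)%C).
  { exists (fun t : R => RtoC (c (1 - t)%R) + (- Ci * a) * RtoC (s (1 - t)%R))%C,
         (fun t : R => RtoC (c (1 - t)%R) + (- Ci * b) * RtoC (s (1 - t)%R))%C.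
    replace (1 - 0) with 1 by ring. replace (1 - 1) with 0 by ring. rewrite Hc0, Hs0.
    split; [split; [|split]|].
    - apply Hcont.
    - apply Hcont.
    - exists nil. intros t _ _. split.
      + eapply is_derive_C_eq; [apply Hd|]. apply injective_projections; simpl; ring.
      + eapply is_derive_C_eq; [apply Hd|]. apply injective_projections; simpl; ring.
    - unfold D. repeat split; apply injective_projections; simpl; field. }
  exists (/ D * 1)%C, (/ D * (Ci * RtoC ((a - b) / 2 * s 1)%R))%C. split.
  - rewrite Cmult_1_r. intros E. apply C1_nz. rewrite <- (Cinv_l D HD), E. ring.
  - rewrite <- (Cinv_l D HD) at 1. apply scatters_scal, H.
Qed.

(** * The planar coefficient matrix *)

Definition mfun (d x : R) : R := / (1 + d * cos (2 * x)).
Definition jfun (d x : R) : R := sin (2 * x) / (1 + d * cos (2 * x)).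
Definition qfun (d la x : R) : R :=
  la ^ 2 + d / sqrt (1 - d ^ 2) * (cos (2 * x) + d / (1 + sqrt (1 - d ^ 2))).

Lemma delta_bounds (eperp epar : R) :
  0 < eperp -> 0 < epar -> -1 < delta eperp epar < 1.
Proof.
  intros H1 H2. unfold delta. split.
  - apply Rlt_div_r; lra.
  - apply Rlt_div_l; lra.
Qed.

Lemma weight_bounds (d x : R) :
  -1 < d < 1 -> 0 < 1 - Rabs d <= 1 + d * cos (2 * x) /\ 1 + d * cos (2 * x) <= 2.
Proof.
  intros Hd. generalize (COS_bound (2 * x)). unfold Rabs. destruct Rcase_abs; nra.
Qed.

Lemma sqrt_delta_pos (d : R) : -1 < d < 1 -> 0 < sqrt (1 - d ^ 2).
Proof. intros Hd. apply sqrt_lt_R0. nra. Qed.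

Lemma sqrt_delta (eperp epar : R) :
  0 < eperp -> 0 < epar ->
  sqrt (1 - delta eperp epar ^ 2) = 2 * n0_sq eperp epar / (eperp + epar).
Proof.
  intros H1 H2. unfold n0_sq.
  assert (Hp : 0 < eperp * epar) by nra.
  assert (Hs := sqrt_lt_R0 _ Hp).
  apply sqrt_lem_1.
  - generalize (delta_bounds eperp epar H1 H2). nra.
  - apply Rlt_le, Rdiv_lt_0_compat; lra.
  - replace (2 * sqrt (eperp * epar) / (eperp + epar) * (2 * sqrt (eperp * epar) / (eperp + epar)))
      with (4 * (sqrt (eperp * epar) * sqrt (eperp * epar)) / (eperp + epar) ^ 2) by (field; lra).
    rewrite sqrt_sqrt by lra. unfold delta. field. lra.
Qed.

Lemma Bmat_planar (eperp epar theta x : R) (i j : nat) :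
  0 < eperp -> 0 < epar -> 0 < cos theta -> (i < 4)%nat -> (j < 4)%nat ->
  let d := delta eperp epar in
  let s := sqrt (1 - d ^ 2) in
  Bmat eperp epar theta x 0 i j =
  match i, j with
  | 0%nat, 0%nat | 1%nat, 1%nat => sin theta * d * jfun d x
  | 0%nat, 1%nat => s * mfun d x * qfun d (cos theta) x / cos theta
  | 1%nat, 0%nat => s * mfun d x * cos theta
  | 2%nat, 3%nat => (cos theta ^ 2 + eperp / n0_sq eperp epar - 1) / cos theta
  | 3%nat, 2%nat => cos theta
  | _, _ => 0
  end.
Proof.
  intros H1 H2 Hc Hi Hj d s.
  assert (Hd : -1 < d < 1) by (apply delta_bounds; trivial).
  assert (Hs : 0 < s) by (apply sqrt_delta_pos; trivial).
  assert (Hs2 : s * s = 1 - d ^ 2) by (apply sqrt_sqrt; nra).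
  assert (Hn : n0_sq eperp epar = s * (eperp + epar) / 2)
    by (unfold s, d; rewrite sqrt_delta by trivial; field; lra).
  assert (Hn2 : n0_sq eperp epar * n0_sq eperp epar = eperp * epar) by (apply sqrt_sqrt; nra).
  assert (Hn0 : 0 < n0_sq eperp epar) by (rewrite Hn; nra).
  destruct (weight_bounds d x Hd) as [[Hw0 Hw] _].
  assert (Ed : epar - eperp = - d * (eperp + epar)) by (unfold d, delta; field; lra).
  assert (E33 : epst eperp epar x 0 2 2 = (1 + d * cos (2 * x)) / s).
  { unfold epst, eps, director; simpl. rewrite Ed, cos_2a_sin, Hn.
    replace eperp with ((eperp + epar) * (1 + d) / 2) at 1 by (unfold d, delta; field; lra).
    field. lra. }
  assert (E13 : epst eperp epar x 0 0 2 = - d * sin (2 * x) / s).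
  { unfold epst, eps, director; simpl. rewrite Ed, sin_2a, Hn, cos_0. field. lra. }
  assert (E11 : epst eperp epar x 0 0 0 * epst eperp epar x 0 2 2 -
                epst eperp epar x 0 0 2 ^ 2 = 1).
  { replace 1 with (eperp * epar / (n0_sq eperp epar * n0_sq eperp epar))
      by (rewrite Hn2; field; lra).
    unfold epst, eps, director; simpl. rewrite cos_0.
    assert (Ht : cos x * cos x = 1 - sin x * sin x)
      by (generalize (sin2_cos2 x); unfold Rsqr; lra).
    apply Rmult_eq_reg_r with (n0_sq eperp epar * n0_sq eperp epar); [|nra].
    field_simplify; [|lra|lra].
    replace (cos x ^ 2) with (1 - sin x ^ 2) by (simpl; lra). ring. }
  assert (E12 : epst eperp epar x 0 0 1 = 0).
  { unfold epst, eps, director; simpl. rewrite sin_0. field. lra. }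
  assert (E23 : epst eperp epar x 0 1 2 = 0).
  { unfold epst, eps, director; simpl. rewrite sin_0. field. lra. }
  assert (E22 : epst eperp epar x 0 1 1 = eperp / n0_sq eperp epar).
  { unfold epst, eps, director; simpl. rewrite sin_0. field. lra. }
  assert (E331 : (1 + d * cos (2 * x)) / s - 1 = d / s * (cos (2 * x) + d / (1 + s))).
  { apply Rminus_diag_uniq.
    replace ((1 + d * cos (2 * x)) / s - 1 - d / s * (cos (2 * x) + d / (1 + s)))
      with ((1 - s * s - d ^ 2) / (s * (1 + s))) by (field; lra).
    rewrite Hs2. field; lra. }
  unfold Bmat. rewrite E11, E12, E23, E22, E13, E33.
  destruct i as [|[|[|[|i]]]]; [| | | |lia];
    (destruct j as [|[|[|[|j]]]]; [| | | |lia]); cbn [nth];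
    unfold jfun, mfun, qfun; fold s; try rewrite <- E331; field; lra.
Qed.

Lemma weight_neq_0 (d x : R) : -1 < d < 1 -> 1 + d * cos (2 * x) <> 0.
Proof. intros Hd. generalize (weight_bounds d x Hd). lra. Qed.

Lemma continuous_mfun (d x : R) : -1 < d < 1 -> continuous (mfun d) x.
Proof.
  intros Hd. apply (ex_derive_continuous (V := R_NormedModule)).
  unfold mfun. auto_derive. repeat split; trivial. now apply weight_neq_0.
Qed.

Lemma continuous_jfun (d x : R) : -1 < d < 1 -> continuous (jfun d) x.
Proof.
  intros Hd. apply (ex_derive_continuous (V := R_NormedModule)).
  unfold jfun. auto_derive. repeat split; trivial. now apply weight_neq_0.
Qed.

Lemma continuous_qfun (d la x : R) : continuous (qfun d la) x.
Proof.
  apply (ex_derive_continuous (V := R_NormedModule)).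
  unfold qfun. auto_derive. trivial.
Qed.

Lemma mfun_bounds (d x : R) : -1 < d < 1 -> / 2 <= mfun d x <= / (1 - Rabs d).
Proof.
  intros Hd. destruct (weight_bounds d x Hd). unfold mfun.
  split; apply Rinv_le_contravar; lra.
Qed.

Section Reparametrization.
Variables (d : R) (psi : R -> R).
Hypotheses (Hd : -1 < d < 1) (Hpsi : piecewise_continuous psi).

Lemma ex_RInt_comp_piecewise (g : R -> R) :
  (forall x, continuous g x) ->
  forall a b, 0 <= a <= b -> b <= 1 -> ex_RInt (fun t => g (psi t)) a b.
Proof. intros Hg. apply ex_RInt_piecewise, piecewise_continuous_comp; trivial. Qed.

Let m (t : R) : R := mfun d (psi t).

Lemma ex_RInt_m (a b : R) : 0 <= a <= b -> b <= 1 -> ex_RInt m a b.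
Proof. apply (ex_RInt_comp_piecewise (mfun d)). intros x. now apply continuous_mfun. Qed.

Lemma RInt_m_ge (a b : R) : 0 <= a <= b -> b <= 1 -> (b - a) / 2 <= RInt m a b.
Proof.
  intros Ha Hb.
  replace ((b - a) / 2) with (RInt (fun _ => / 2) a b)
    by (rewrite RInt_const; unfold scal; simpl; unfold mult; simpl; field).
  apply RInt_le; [lra|apply ex_RInt_const|now apply ex_RInt_m|].
  intros x _. apply mfun_bounds; trivial.
Qed.

Lemma Ncal_pos : 0 < Ncal d psi.
Proof. generalize (RInt_m_ge 0 1 ltac:(lra) ltac:(lra)). change (Ncal d psi) with (RInt m 0 1). lra. Qed.

Lemma tau_0 : tau d psi 0 = 0.
Proof. unfold tau. rewrite RInt_point. apply Rmult_0_r. Qed.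

Lemma tau_1 : tau d psi 1 = 1.
Proof. unfold tau. fold (Ncal d psi). apply Rinv_l. generalize Ncal_pos; lra. Qed.

Lemma tau_increase (s t : R) :
  unit_interval s -> unit_interval t -> s <= t ->
  (t - s) / (2 * Ncal d psi) <= tau d psi t - tau d psi s.
Proof.
  unfold unit_interval. intros Hs Ht Hst. unfold tau.
  change (fun s => / (1 + d * cos (2 * psi s))) with m.
  assert (H := RInt_Chasles (V := R_CompleteNormedModule) m 0 s t
                 (ex_RInt_m 0 s ltac:(lra) ltac:(lra)) (ex_RInt_m s t ltac:(lra) ltac:(lra))).
  unfold plus in H; simpl in H. rewrite <- H.
  assert (HN := Ncal_pos).
  replace ((t - s) / (2 * Ncal d psi)) with (/ Ncal d psi * ((t - s) / 2)) by (field; lra).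
  replace (/ Ncal d psi * (RInt m 0 s + RInt m s t) - / Ncal d psi * RInt m 0 s)
    with (/ Ncal d psi * RInt m s t) by ring.
  apply Rmult_le_compat_l; [apply Rlt_le, Rinv_0_lt_compat, HN|].
  apply RInt_m_ge; lra.
Qed.

Lemma tau_le (s t : R) :
  unit_interval s -> unit_interval t -> s <= t -> tau d psi s <= tau d psi t.
Proof.
  intros Hs Ht Hst. generalize (tau_increase s t Hs Ht Hst).
  assert (0 <= (t - s) / (2 * Ncal d psi)); [|lra].
  apply Rdiv_le_0_compat; [lra|]. generalize Ncal_pos; lra.
Qed.

Lemma tau_unit (t : R) : unit_interval t -> unit_interval (tau d psi t).
Proof.
  intros Ht. generalize (tau_le 0 t) (tau_le t 1). rewrite tau_0, tau_1.
  unfold unit_interval in *. intros H1 H2. split; [apply H1|apply H2]; lra.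
Qed.

Lemma tau_contract (s t : R) :
  unit_interval s -> unit_interval t ->
  Rabs (t - s) <= 2 * Ncal d psi * Rabs (tau d psi t - tau d psi s).
Proof.
  intros Hs Ht. assert (HN := Ncal_pos).
  destruct (Rle_dec s t) as [Hst|Hst].
  - generalize (tau_increase s t Hs Ht Hst) (tau_le s t Hs Ht Hst). intros H H'.
    rewrite 2!Rabs_pos_eq by lra. apply Rle_div_l in H; [|lra]. lra.
  - assert (Hts : t <= s) by lra.
    generalize (tau_increase t s Ht Hs Hts) (tau_le t s Ht Hs Hts). intros H H'.
    rewrite 2!Rabs_left1 by lra. apply Rle_div_l in H; [|lra]. lra.
Qed.

Lemma tau_continuous : continuous_on unit_interval (tau d psi).
Proof.
  apply (lipschitz_continuous_on _ (/ Ncal d psi * / (1 - Rabs d))).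
  intros s t Hs Ht Hst. unfold tau.
  change (fun s => / (1 + d * cos (2 * psi s))) with m.
  assert (HN := Rinv_0_lt_compat _ Ncal_pos).
  rewrite <- Rmult_minus_distr_l, Rabs_mult, Rmult_assoc, (Rabs_pos_eq (/ _)) by lra.
  apply Rmult_le_compat_l; [lra|].
  apply lipschitz_primitive; trivial; [apply ex_RInt_m|].
  intros x. destruct (mfun_bounds d (psi x) Hd). unfold m. rewrite Rabs_pos_eq; lra.
Qed.

Lemma tau_derive (t : R) :
  0 < t < 1 -> continuous psi t -> is_derive (tau d psi) t (/ Ncal d psi * mfun d (psi t)).
Proof.
  intros Ht Hc. apply (is_derive_scal (fun t => RInt m 0 t)).
  apply (is_derive_primitive m t); trivial; [apply ex_RInt_m|].
  apply (continuous_comp psi (mfun d)); trivial. now apply continuous_mfun.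
Qed.

Lemma mu_spec (s : R) :
  unit_interval s -> unit_interval (mu d psi s) /\ tau d psi (mu d psi s) = s.
Proof.
  intros Hs. unfold mu.
  destruct (IVT_gen (fun t => tau d psi (clamp t)) 0 1 s) as (t & Ht & Hts).
  - intros t. apply continuity_pt_filterlim, (continuous_clamp _ tau_continuous).
  - rewrite !clamp_id by (unfold unit_interval; lra). rewrite tau_0, tau_1.
    unfold unit_interval in Hs. rewrite Rmin_left, Rmax_right; lra.
  - rewrite Rmin_left, Rmax_right in Ht by lra. rewrite clamp_id in Hts by exact Ht.
    rewrite (the_unique 0 _ t); [split; assumption|split; assumption|].
    intros y [Hy Hys]. generalize (tau_contract t y Ht Hy).
    rewrite Hys, Hts, Rminus_diag, Rabs_R0, Rmult_0_r. intros H.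
    generalize (Rabs_pos (y - t)); intros H'.
    apply Rminus_diag_uniq. destruct (Req_dec (y - t) 0) as [E|E]; trivial.
    apply Rabs_pos_lt in E. lra.
Qed.

Lemma tau_inj (s t : R) :
  unit_interval s -> unit_interval t -> tau d psi s = tau d psi t -> s = t.
Proof.
  intros Hs Ht E. generalize (tau_contract s t Hs Ht).
  rewrite E, Rminus_diag, Rabs_R0, Rmult_0_r. intros H.
  destruct (Req_dec (t - s) 0) as [E'|E']; [lra|]. apply Rabs_pos_lt in E'. lra.
Qed.

Lemma mu_tau (t : R) : unit_interval t -> mu d psi (tau d psi t) = t.
Proof.
  intros Ht. destruct (mu_spec _ (tau_unit t Ht)) as [H1 H2]. now apply tau_inj.
Qed.

Lemma tau_interior (t : R) : 0 < t < 1 -> 0 < tau d psi t < 1.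
Proof.
  intros Ht. assert (HN := Ncal_pos).
  generalize (tau_increase 0 t) (tau_increase t 1). rewrite tau_0, tau_1.
  unfold unit_interval. intros H1 H2.
  specialize (H1 ltac:(lra) ltac:(lra) ltac:(lra)).
  specialize (H2 ltac:(lra) ltac:(lra) ltac:(lra)).
  assert (0 < (t - 0) / (2 * Ncal d psi)) by (apply Rdiv_lt_0_compat; lra).
  assert (0 < (1 - t) / (2 * Ncal d psi)) by (apply Rdiv_lt_0_compat; lra).
  lra.
Qed.

Lemma unit_0 : unit_interval 0. Proof. unfold unit_interval; lra. Qed.
Lemma unit_1 : unit_interval 1. Proof. unfold unit_interval; lra. Qed.

Lemma mu_0 : mu d psi 0 = 0.
Proof. rewrite <- tau_0 at 1. apply mu_tau, unit_0. Qed.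

Lemma mu_1 : mu d psi 1 = 1.
Proof. rewrite <- tau_1 at 1. apply mu_tau, unit_1. Qed.

Lemma mu_interior (s : R) : 0 < s < 1 -> 0 < mu d psi s < 1.
Proof.
  intros Hs. destruct (mu_spec s) as [[H0 H1] H2]; [unfold unit_interval; lra|].
  split.
  - destruct H0 as [H0|H0]; trivial. rewrite <- H0, tau_0 in H2. lra.
  - destruct H1 as [H1|H1]; trivial. rewrite H1, tau_1 in H2. lra.
Qed.

Lemma mu_contract (s t : R) :
  unit_interval s -> unit_interval t ->
  Rabs (mu d psi t - mu d psi s) <= 2 * Ncal d psi * Rabs (t - s).
Proof.
  intros Hs Ht. destruct (mu_spec s Hs) as [H1 H2]. destruct (mu_spec t Ht) as [H3 H4].
  generalize (tau_contract _ _ H1 H3). now rewrite H2, H4.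
Qed.

Lemma mu_continuous : continuous_on unit_interval (mu d psi).
Proof.
  apply (lipschitz_continuous_on _ (2 * Ncal d psi)).
  intros s t Hs Ht Hst. rewrite <- (Rabs_pos_eq (t - s)) by lra. now apply mu_contract.
Qed.

Lemma mu_derive (s : R) :
  0 < s < 1 -> continuous psi (mu d psi s) ->
  is_derive (mu d psi) s (Ncal d psi / mfun d (psi (mu d psi s))).
Proof.
  intros Hs Hc. set (t := mu d psi s).
  assert (Hsu : unit_interval s) by (unfold unit_interval; lra).
  assert (Ht : 0 < t < 1) by now apply mu_interior.
  assert (HD := tau_derive t Ht Hc).
  set (D := / Ncal d psi * mfun d (psi t)) in HD.
  assert (HN := Ncal_pos).
  assert (Hm : 0 < mfun d (psi t)) by (generalize (mfun_bounds d (psi t) Hd); lra).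
  assert (HDp : 0 < D) by (apply Rmult_lt_0_compat; trivial; now apply Rinv_0_lt_compat).
  replace (Ncal d psi / mfun d (psi t)) with (/ D) by (unfold D; field; lra).
  apply is_derive_Reals in HD. apply is_derive_Reals.
  intros e He.
  destruct (HD (e * D / (2 * Ncal d psi))) as [r Hr].
  { apply Rdiv_lt_0_compat; nra. }
  destruct (locally_unit s Hs) as [r' Hr'].
  assert (Hr0 : 0 < Rmin r' (r / (2 * Ncal d psi))).
  { apply Rmin_pos; [apply r'|]. apply Rdiv_lt_0_compat; [apply r|lra]. }
  exists (mkposreal _ Hr0). intros h Hh0 Hh. simpl in Hh.
  assert (Hsh : 0 < s + h < 1).
  { apply Hr'. unfold ball; simpl; unfold AbsRing_ball, abs, minus, plus, opp; simpl.
    replace (s + h + - s) with h by ring.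
    apply Rlt_le_trans with (1 := Hh), Rmin_l. }
  assert (Hshu : unit_interval (s + h)) by (unfold unit_interval; lra).
  destruct (mu_spec (s + h) Hshu) as [H1 H2]. destruct (mu_spec s Hsu) as [H3 H4].
  fold t in H4.
  set (k := mu d psi (s + h) - t).
  assert (Ek : mu d psi (s + h) = t + k) by (unfold k; ring).
  assert (Hk : Rabs k <= 2 * Ncal d psi * Rabs h).
  { unfold k, t. replace h with (s + h - s) at 2 by ring. now apply mu_contract. }
  assert (Hk0 : k <> 0).
  { intros E. apply Hh0. rewrite Ek, E, Rplus_0_r, H4 in H2. lra. }
  specialize (Hr k Hk0). rewrite <- Ek, H2, H4 in Hr. rewrite Ek. fold t.
  replace (s + h - s) with h in Hr by ring. replace (t + k - t) with k by ring.
  assert (Hkr : Rabs k < r).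
  { apply Rle_lt_trans with (1 := Hk). rewrite Rmult_comm. apply Rlt_div_r; [lra|].
    apply Rlt_le_trans with (1 := Hh), Rmin_r. }
  specialize (Hr Hkr).
  replace (k / h - / D) with (- ((h / k - D) * (k / h) * / D)) by (field; repeat split; lra).
  rewrite Rabs_Ropp, !Rabs_mult, (Rabs_pos_eq (/ D)) by (apply Rlt_le, Rinv_0_lt_compat, HDp).
  assert (Hkh : Rabs (k / h) <= 2 * Ncal d psi).
  { unfold Rdiv. rewrite Rabs_mult, Rabs_inv. apply Rle_div_l; trivial. now apply Rabs_pos_lt. }
  apply Rmult_lt_reg_r with D; trivial. rewrite Rmult_assoc, Rinv_l, Rmult_1_r by lra.
  apply Rlt_div_r in Hr; [|lra].
  apply Rle_lt_trans with (2 := Hr).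
  apply Rmult_le_compat_l; [apply Rabs_pos|trivial].
Qed.

End Reparametrization.

(** * Gauge and time change *)

Lemma continuous_Bmat (eperp epar theta x : R) (i j : nat) :
  0 < eperp -> 0 < epar -> 0 < cos theta -> (i < 4)%nat -> (j < 4)%nat ->
  continuous (fun x => Bmat eperp epar theta x 0 i j) x.
Proof.
  intros H1 H2 Hc Hi Hj.
  assert (Hd := delta_bounds _ _ H1 H2).
  eapply continuous_ext; [intros y; symmetry; now apply Bmat_planar|].
  apply (ex_derive_continuous (V := R_NormedModule)).
  destruct i as [|[|[|[|i]]]]; [| | | |lia];
    (destruct j as [|[|[|[|j]]]]; [| | | |lia]); cbn beta iota zeta;
    unfold jfun, mfun, qfun; auto_derive; repeat split; trivial; now apply weight_neq_0.
Qed.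

Section Planar.
Variables (eta eperp epar : R) (psi : R -> R).
Hypotheses (Heta : 0 < eta) (Hperp : 0 < eperp) (Hpar : 0 < epar).
Hypothesis (Hpsi : piecewise_continuous psi).

Let d : R := delta eperp epar.
Let Hd : -1 < d < 1 := delta_bounds eperp epar Hperp Hpar.

Definition entry (theta : R) (i j : nat) (t : R) : R :=
  Bmat eperp epar theta (psi t) 0 i j / eta.

Lemma transmission_scatters (theta : R) (I1 I2 T1 T2 R1 R2 : C) :
  0 < cos theta ->
  (exists Z : nat -> R -> C,
      transmission_solution eta eperp epar psi (fun _ => 0) theta Z /\
      Z 0%nat 0 = (I1 - R1)%C /\ Z 1%nat 0 = (I1 + R1)%C /\
      Z 2%nat 0 = (I2 - R2)%C /\ Z 3%nat 0 = (I2 + R2)%C /\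
      Z 0%nat 1 = T1 /\ Z 1%nat 1 = T1 /\ Z 2%nat 1 = T2 /\ Z 3%nat 1 = T2) <->
  scatters (entry theta 0 0) (entry theta 0 1) (entry theta 1 0) I1 T1 R1 /\
  scatters (fun _ => 0) (entry theta 2 3) (entry theta 3 2) I2 T2 R2.
Proof.
  intros Hc.
  assert (HeC : RtoC eta <> 0) by (intros E; injection E; lra).
  assert (Hent : forall i j t, RtoC (entry theta i j t) =
            (RtoC (Bmat eperp epar theta (psi t) 0 i j) / RtoC eta)%C).
  { intros i j t. unfold entry. apply RtoC_div. lra. }
  split.
  - intros (Z & [HZc HZ] & B0 & B1 & B2 & B3 & C0 & C1 & C2 & C3).
    destruct Hpsi as [[l Hl] _].
    assert (HD : forall t, 0 < t < 1 -> ~ In t l -> forall i, (i < 4)%nat ->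
       is_derive (Z i) t (Ci / eta * sum_n (fun j => (Bmat eperp epar theta (psi t) 0 i j * Z j t)%C) 3)%C).
    { intros t Ht Hi. apply HZ; trivial. intros i j Hi' Hj'.
      apply (continuous_comp psi (fun x => Bmat eperp epar theta x 0 i j)); auto.
      now apply continuous_Bmat. }
    split.
    + exists (Z 0%nat), (Z 1%nat). split; [|auto].
      split; [apply HZc; lia|split; [apply HZc; lia|]].
      exists l. intros t Ht Hi. split.
      * eapply is_derive_C_eq; [apply (HD t Ht Hi 0%nat); lia|].
        rewrite !sum_Sn, sum_O. unfold plus; simpl. rewrite !Hent.
        rewrite (Bmat_planar _ _ _ _ 0 2), (Bmat_planar _ _ _ _ 0 3) by (trivial; lia).
        field. trivial.
      * eapply is_derive_C_eq; [apply (HD t Ht Hi 1%nat); lia|].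
        rewrite !sum_Sn, sum_O. unfold plus; simpl. rewrite !Hent.
        rewrite (Bmat_planar _ _ _ _ 1 2), (Bmat_planar _ _ _ _ 1 3),
          (Bmat_planar _ _ _ _ 1 1), (Bmat_planar _ _ _ _ 0 0) by (trivial; lia).
        field. trivial.
    + exists (Z 2%nat), (Z 3%nat). split; [|auto].
      split; [apply HZc; lia|split; [apply HZc; lia|]].
      exists l. intros t Ht Hi. split.
      * eapply is_derive_C_eq; [apply (HD t Ht Hi 2%nat); lia|].
        rewrite !sum_Sn, sum_O. unfold plus; simpl. rewrite !Hent.
        rewrite (Bmat_planar _ _ _ _ 2 0), (Bmat_planar _ _ _ _ 2 1),
          (Bmat_planar _ _ _ _ 2 2) by (trivial; lia).
        field. trivial.
      * eapply is_derive_C_eq; [apply (HD t Ht Hi 3%nat); lia|].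
        rewrite !sum_Sn, sum_O. unfold plus; simpl. rewrite !Hent.
        rewrite (Bmat_planar _ _ _ _ 3 0), (Bmat_planar _ _ _ _ 3 1),
          (Bmat_planar _ _ _ _ 3 3) by (trivial; lia).
        field. trivial.
  - intros [(u & v & Huv & B0 & B1 & C0 & C1) (w & z & Hwz & B2 & B3 & C2 & C3)].
    exists (fun i => match i with 0%nat => u | 1%nat => v | 2%nat => w | _ => z end).
    split; [|tauto]. split.
    + intros i Hi. destruct Huv as (Hu & Hv & _). destruct Hwz as (Hw & Hz & _).
      destruct i as [|[|[|i]]]; trivial.
    + intros t Ht HB i Hi.
      assert (He : forall i j, (i < 4)%nat -> (j < 4)%nat -> continuous (entry theta i j) t).
      { intros i' j' Hi' Hj'. unfold entry, Rdiv.
        apply (continuous_mult (K := R_AbsRing)); [now apply HB|apply continuous_const]. }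
      destruct (solution_regular _ _ _ _ _ t Huv Ht) as [D0 D1]; try (apply He; lia).
      destruct (solution_regular _ _ _ _ _ t Hwz Ht) as [D2 D3]; try (apply He; lia);
        [apply continuous_const|].
      destruct i as [|[|[|[|i]]]]; [| | | |lia].
      * eapply is_derive_C_eq; [exact D0|].
        rewrite !sum_Sn, sum_O. unfold plus; simpl. rewrite !Hent.
        rewrite (Bmat_planar _ _ _ _ 0 2), (Bmat_planar _ _ _ _ 0 3) by (trivial; lia).
        field. trivial.
      * eapply is_derive_C_eq; [exact D1|].
        rewrite !sum_Sn, sum_O. unfold plus; simpl. rewrite !Hent.
        rewrite (Bmat_planar _ _ _ _ 1 2), (Bmat_planar _ _ _ _ 1 3),
          (Bmat_planar _ _ _ _ 1 1), (Bmat_planar _ _ _ _ 0 0) by (trivial; lia).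
        field. trivial.
      * eapply is_derive_C_eq; [exact D2|].
        rewrite !sum_Sn, sum_O. unfold plus; simpl. rewrite !Hent.
        rewrite (Bmat_planar _ _ _ _ 2 0), (Bmat_planar _ _ _ _ 2 1),
          (Bmat_planar _ _ _ _ 2 2) by (trivial; lia).
        field. trivial.
      * eapply is_derive_C_eq; [exact D3|].
        rewrite !sum_Sn, sum_O. unfold plus; simpl. rewrite !Hent.
        rewrite (Bmat_planar _ _ _ _ 3 0), (Bmat_planar _ _ _ _ 3 1),
          (Bmat_planar _ _ _ _ 3 3) by (trivial; lia).
        field. trivial.
Qed.

Lemma eta_tilde_pos : 0 < eta_tilde eta d psi.
Proof.
  unfold eta_tilde. apply Rdiv_lt_0_compat; trivial.
  apply Rmult_lt_0_compat; [now apply sqrt_delta_pos|now apply Ncal_pos].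
Qed.

Definition reduced_scatters (la : R) : C -> C -> C -> Prop :=
  scatters (fun _ => 0)
    (fun t => qfun d la (psi (mu d psi t)) / (eta_tilde eta d psi * la))
    (fun _ => la / eta_tilde eta d psi).

Lemma reduced_solution_scatters (la : R) (T R0 : C) :
  0 < la ->
  (exists u1 u2 : R -> C,
      reduced_solution eta d psi la u1 u2 /\
      u1 0 = (1 - R0)%C /\ u2 0 = (1 + R0)%C /\ u1 1 = T /\ u2 1 = T) <->
  reduced_scatters la 1 T R0.
Proof.
  intros Hla. assert (Het := eta_tilde_pos).
  assert (HlC : RtoC la <> 0) by (intros E; injection E; lra).
  assert (HeC : RtoC (eta_tilde eta d psi) <> 0) by (intros E; injection E; lra).
  split.
  - intros (u & v & (Hu & Hv & Huv) & Hbc). exists u, v. split; [|exact Hbc].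
    split; [|split]; trivial.
    destruct (proj1 Hpsi) as [l Hl]. exists (map (tau d psi) l). intros t Ht Hi.
    assert (Htu : unit_interval t) by (unfold unit_interval; lra).
    destruct (mu_spec d psi Hd Hpsi t Htu) as [_ Htau].
    destruct (Huv t Ht) as (du & dv & D1 & D2 & E1 & E2).
    { apply (continuous_comp (mu d psi) (fun t => qfun d la (psi t))).
      - apply continuous_on_interior; trivial. now apply mu_continuous.
      - apply (continuous_comp psi (qfun d la)); [|apply continuous_qfun].
        apply Hl; [now apply mu_interior|].
        intros Hi'. apply Hi. rewrite <- Htau. now apply in_map. }
    fold (qfun d la (psi (mu d psi t))) in E1.
    split.
    + eapply is_derive_C_eq; [exact D1|]. rewrite RtoC_div, RtoC_mult by nra.
      replace du with ((eta_tilde eta d psi * la * du) / (eta_tilde eta d psi * la))%C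
        by (field; auto).
      rewrite E1. field. auto.
    + eapply is_derive_C_eq; [exact D2|]. rewrite RtoC_div by lra.
      replace dv with ((eta_tilde eta d psi * dv) / (eta_tilde eta d psi))%C by (field; auto).
      rewrite E2. field. auto.
  - intros (u & v & Huv & Hbc). exists u, v. split; [|exact Hbc].
    split; [apply Huv|split; [apply Huv|]]. intros t Ht Hq.
    destruct (solution_regular _ _ _ _ _ t Huv Ht) as [D1 D2].
    + apply continuous_const.
    + unfold Rdiv. apply (continuous_mult (K := R_AbsRing)); [exact Hq|apply continuous_const].
    + apply continuous_const.
    + do 2 eexists. split; [exact D1|split; [exact D2|]].
      fold (qfun d la (psi (mu d psi t))).
      rewrite !RtoC_div, RtoC_mult by nra. split; field; auto.
Qed.

Definition phase (theta t : R) : R :=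
  / eta * d * sin theta *
  RInt (fun s => sin (2 * psi s) / (1 + d * cos (2 * psi s))) 0 t.

Lemma phase_continuous (theta : R) : continuous_on unit_interval (phase theta).
Proof.
  apply (continuous_on_Rmult (fun _ => _)).
  - intros t Ht. apply filterlim_const.
  - apply (lipschitz_continuous_on _ (/ (1 - Rabs d))).
    apply lipschitz_primitive.
    + apply (ex_RInt_comp_piecewise psi Hpsi (jfun d)). intros x. now apply continuous_jfun.
    + intros t. destruct (mfun_bounds d (psi t) Hd) as [H1 H2]. unfold Rdiv.
      change (/ (1 + d * cos (2 * psi t))) with (mfun d (psi t)).
      rewrite Rabs_mult, (Rabs_pos_eq (mfun _ _)) by lra.
      generalize (SIN_bound (2 * psi t)). intros H3.
      assert (H4 : Rabs (sin (2 * psi t)) <= 1) by (apply Rabs_le; lra).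
      generalize (Rabs_pos (sin (2 * psi t))). nra.
Qed.

Lemma phase_0 (theta : R) : phase theta 0 = 0.
Proof. unfold phase. rewrite RInt_point. apply Rmult_0_r. Qed.

Lemma phase_derive (theta t : R) :
  0 < t < 1 -> continuous psi t ->
  is_derive (phase theta) t (/ eta * d * sin theta * jfun d (psi t)).
Proof.
  intros Ht Hc. apply (is_derive_scal (fun t => RInt (fun s => jfun d (psi s)) 0 t)).
  apply (is_derive_primitive (fun s => jfun d (psi s))); trivial.
  - apply (ex_RInt_comp_piecewise psi Hpsi (jfun d)). intros x. now apply continuous_jfun.
  - apply (continuous_comp psi (jfun d)); trivial. now apply continuous_jfun.
Qed.

Lemma entry_00 (theta t : R) :
  0 < cos theta -> entry theta 0 0 t = / eta * d * sin theta * jfun d (psi t).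
Proof.
  intros Hc. unfold entry. rewrite (Bmat_planar _ _ _ _ 0 0) by (trivial; lia).
  fold d. field. lra.
Qed.

Lemma entry_01 (theta t : R) :
  0 < cos theta ->
  entry theta 0 1 t = / Ncal d psi * mfun d (psi t) *
    (qfun d (cos theta) (psi t) / (eta_tilde eta d psi * cos theta)).
Proof.
  intros Hc. unfold entry. rewrite (Bmat_planar _ _ _ _ 0 1) by (trivial; lia).
  fold d. unfold eta_tilde.
  generalize (Ncal_pos d psi Hd Hpsi) (sqrt_delta_pos d Hd). intros HN Hs.
  field. lra.
Qed.

Lemma entry_10 (theta t : R) :
  0 < cos theta ->
  entry theta 1 0 t = / Ncal d psi * mfun d (psi t) * (cos theta / eta_tilde eta d psi).
Proof.
  intros Hc. unfold entry. rewrite (Bmat_planar _ _ _ _ 1 0) by (trivial; lia).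
  fold d. unfold eta_tilde.
  generalize (Ncal_pos d psi Hd Hpsi) (sqrt_delta_pos d Hd). intros HN Hs.
  field. lra.
Qed.

Lemma scatters_of_reduced (theta : R) (I0 T R0 : C) :
  0 < cos theta -> reduced_scatters (cos theta) I0 T R0 ->
  scatters (entry theta 0 0) (entry theta 0 1) (entry theta 1 0)
    I0 (T * Cexpi (phase theta 1)) R0.
Proof.
  intros Hc H. destruct (proj1 Hpsi) as [l Hl].
  apply (scatters_time_change _ _ _ (tau d psi)
           (fun t => / Ncal d psi * mfun d (psi t)) (mu d psi)) in H.
  - apply (scatters_gauge _ _ _ (phase theta)
             (fun t => / eta * d * sin theta * jfun d (psi t))) in H.
    + revert H. apply scatters_ext. intros t Ht.
      rewrite entry_00, entry_01, entry_10, mu_tau by (trivial; unfold unit_interval; lra).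
      repeat split; ring.
    + apply phase_continuous.
    + apply phase_0.
    + exists l. intros t Ht Hi. apply phase_derive; auto.
  - now apply tau_continuous.
  - now apply tau_0.
  - now apply tau_1.
  - now apply tau_unit.
  - intros t Ht. split; [now apply tau_interior|].
    apply mu_tau; trivial. unfold unit_interval; lra.
  - exists l. intros t Ht Hi. apply tau_derive; auto.
Qed.

Lemma reduced_of_scatters (theta : R) (I0 T R0 : C) :
  0 < cos theta ->
  scatters (entry theta 0 0) (entry theta 0 1) (entry theta 1 0) I0 T R0 ->
  reduced_scatters (cos theta) I0 (T * Cexpi (- phase theta 1)) R0.
Proof.
  intros Hc H. destruct (proj1 Hpsi) as [l Hl].
  apply (scatters_gauge _ _ _ (fun t => - phase theta t)
             (fun t => - (/ eta * d * sin theta * jfun d (psi t)))) in H.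
  - apply (scatters_time_change _ _ _ (mu d psi)
           (fun s => Ncal d psi / mfun d (psi (mu d psi s))) (tau d psi)) in H.
    + revert H. apply scatters_ext. intros t Ht.
      rewrite entry_00, entry_01, entry_10 by trivial.
      generalize (Ncal_pos d psi Hd Hpsi) (mfun_bounds d (psi (mu d psi t)) Hd) eta_tilde_pos.
      intros HN Hm Het. repeat split; try field; lra.
    + now apply mu_continuous.
    + now apply mu_0.
    + now apply mu_1.
    + intros t Ht. now apply mu_spec.
    + intros t Ht. split; [now apply mu_interior|].
      apply mu_spec; trivial. unfold unit_interval; lra.
    + exists (map (tau d psi) l). intros t Ht Hi. apply mu_derive; trivial.
      apply Hl; [now apply mu_interior|]. intros Hi'. apply Hi.
      destruct (mu_spec d psi Hd Hpsi t) as [_ <-]; [unfold unit_interval; lra|].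
      now apply in_map.
  - intros t Ht. apply (filterlim_Ropp_fun _ (phase theta)). now apply phase_continuous.
  - rewrite phase_0. ring.
  - exists l. intros t Ht Hi. apply (is_derive_opp (phase theta)). apply phase_derive; auto.
Qed.

End Planar.

Lemma qfun_bounded (d la x : R) :
  Rabs (qfun d la x) <=
  la ^ 2 + Rabs (d / sqrt (1 - d ^ 2)) * (1 + Rabs (d / (1 + sqrt (1 - d ^ 2)))).
Proof.
  unfold qfun. apply Rle_trans with (1 := Rabs_triang _ _).
  rewrite Rabs_mult, (Rabs_pos_eq (la ^ 2)) by apply pow2_ge_0.
  apply Rplus_le_compat_l, Rmult_le_compat_l; [apply Rabs_pos|].
  apply Rle_trans with (1 := Rabs_triang _ _). apply Rplus_le_compat_r.
  generalize (COS_bound (2 * x)). intros H. apply Rabs_le. lra.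
Qed.

Lemma Cexpi_plus (x y : R) : Cexpi (x + y) = (Cexpi x * Cexpi y)%C.
Proof.
  unfold Cexpi. rewrite cos_plus, sin_plus. apply injective_projections; simpl; ring.
Qed.

Lemma Cexpi_opp (x : R) : (Cexpi (- x) * Cexpi x)%C = 1.
Proof. rewrite <- Cexpi_plus, Rplus_opp_l. apply Cexpi_0. Qed.

Lemma Cexpi_neq_0 (x : R) : Cexpi x <> 0.
Proof. intros E. generalize (Cexpi_opp x). rewrite E, Cmult_0_r. intros H. now apply C1_nz. Qed.

Lemma Cexpi_inv (x : R) : Cexpi (- x) = (/ Cexpi x)%C.
Proof.
  rewrite <- (Cmult_1_l (/ Cexpi x)), <- (Cexpi_opp x). field. apply Cexpi_neq_0.
Qed.

Lemma Cmult_Cexpi_eq_0 (z : C) (x : R) : (z * Cexpi x = 0)%C -> z = 0.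
Proof.
  intros H. rewrite <- (Cmult_1_r z), <- (Cexpi_opp x).
  replace (z * (Cexpi (- x) * Cexpi x))%C with (z * Cexpi x * Cexpi (- x))%C by ring.
  rewrite H. ring.
Qed.

Section Planar.
Variables (eta eperp epar : R).
Hypotheses (Heta : 0 < eta) (Hperp : 0 < eperp) (Hpar : 0 < epar).

Lemma reduced_scatters_T_neq_0 (psi : R -> R) (la : R) (T R0 : C) :
  0 < la -> reduced_scatters eta eperp epar psi la 1 T R0 -> T <> 0.
Proof.
  intros Hla H. set (d := delta eperp epar).
  set (M := la ^ 2 + Rabs (d / sqrt (1 - d ^ 2)) * (1 + Rabs (d / (1 + sqrt (1 - d ^ 2))))).
  set (et := eta_tilde eta d psi).
  apply (scatters_T_neq_0 _ _ _ (M * Rabs (/ (et * la)) + Rabs (la / et)) _ _ _) with (2 := H).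
  - intros t. fold d et. unfold Rminus at 1.
    apply Rle_trans with (1 := Rabs_triang _ _). rewrite Rabs_Ropp.
    apply Rplus_le_compat_r. unfold Rdiv at 1. rewrite Rabs_mult.
    apply Rmult_le_compat_r; [apply Rabs_pos|apply qfun_bounded].
  - exact C1_nz.
Qed.

Lemma Tfun_cases (psi : R -> R) (la : R) :
  piecewise_continuous psi -> 0 < la ->
  (Tfun eta eperp epar psi la <> 0 /\
   exists R0, reduced_scatters eta eperp epar psi la 1 (Tfun eta eperp epar psi la) R0) \/
  (Tfun eta eperp epar psi la = 0 /\
   forall T R0, ~ reduced_scatters eta eperp epar psi la 1 T R0).
Proof.
  intros Hpsi Hla.
  assert (Heq := reduced_solution_scatters eta eperp epar psi Heta Hperp Hpar Hpsi la).
  destruct (classic (exists T R0, reduced_scatters eta eperp epar psi la 1 T R0))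
    as [(T & R0 & H)|Hn].
  - left. unfold Tfun, reduced_transmission.
    rewrite (the_unique _ _ (T, R0)).
    + split; [now apply (reduced_scatters_T_neq_0 psi la T R0)|]. now exists R0.
    + now apply Heq.
    + intros [T' R0'] H'. apply Heq in H'; trivial.
      destruct (scatters_unique _ _ _ _ _ _ _ _ H H') as [-> ->]. reflexivity.
  - right. split.
    + unfold Tfun, reduced_transmission. rewrite the_none; [reflexivity|].
      intros [T R0] H. apply Heq in H; trivial. eauto.
    + intros T R0 H. eauto.
Qed.

Definition amplitudes (psi : R -> R) (I1 I2 : C) (theta : R) : C * C :=
  fst (fst (transmission eta eperp epar psi (fun _ => 0) I1 I2 theta)).

(* Without existence of the solution with [I1 <> 0], [transmission] takes its default value. *)
Lemma amplitudes_planar (theta : R) :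
  0 < cos theta ->
  exists te : C, te <> 0 /\
  forall (psi : R -> R) (I1 I2 : C), piecewise_continuous psi ->
  let T := Tfun eta eperp epar psi (cos theta) in
  (I1 = 0 \/ T <> 0 ->
   amplitudes psi I1 I2 theta =
     ((I1 * (T * Cexpi (phase eta eperp epar psi theta 1)))%C, (I2 * te)%C)) /\
  (I1 <> 0 -> T = 0 -> amplitudes psi I1 I2 theta = (RtoC 0, RtoC 0)).
Proof.
  intros Hc.
  destruct (scatters_constant
              ((cos theta ^ 2 + eperp / n0_sq eperp epar - 1) / cos theta / eta)
              (cos theta / eta)) as (te & re & Hte & Hsc).
  exists te. split; trivial. intros psi I1 I2 Hpsi T.
  assert (Heq := fun T1 T2 R1 R2 =>
     transmission_scatters eta eperp epar psi Heta Hperp Hpar Hpsi theta I1 I2 T1 T2 R1 R2 Hc).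
  assert (HTE : scatters (fun _ => 0) (entry eta eperp epar psi theta 2 3)
                  (entry eta eperp epar psi theta 3 2) I2 (I2 * te) (I2 * re)).
  { rewrite <- (Cmult_1_r I2) at 1. apply scatters_scal.
    revert Hsc. apply scatters_ext. intros t Ht. unfold entry.
    rewrite (Bmat_planar _ _ _ _ 2 3), (Bmat_planar _ _ _ _ 3 2) by (trivial; lia).
    repeat split. }
  split.
  - intros HIT.
    assert (HTM : exists r, scatters (entry eta eperp epar psi theta 0 0)
              (entry eta eperp epar psi theta 0 1) (entry eta eperp epar psi theta 1 0)
              I1 (I1 * (T * Cexpi (phase eta eperp epar psi theta 1))) r).
    { destruct HIT as [->|HT].
      - exists 0. rewrite Cmult_0_l. apply scatters_0.
      - destruct (Tfun_cases psi (cos theta) Hpsi Hc) as [[_ [r H]]|[H _]];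
          [|destruct (HT H)].
        apply scatters_of_reduced in H; trivial.
        exists (I1 * r)%C. rewrite <- (Cmult_1_r I1) at 1. now apply scatters_scal. }
    destruct HTM as [r HTM].
    unfold amplitudes, transmission.
    rewrite (the_unique _ _ ((I1 * (T * Cexpi (phase eta eperp epar psi theta 1)))%C,
                             (I2 * te)%C, r, (I2 * re)%C)); [reflexivity| |].
    + apply Heq. split; assumption.
    + intros [[[T1 T2] R1] R2] H. apply Heq in H as [H1 H2].
      destruct (scatters_unique _ _ _ _ _ _ _ _ H1 HTM) as [-> ->].
      destruct (scatters_unique _ _ _ _ _ _ _ _ H2 HTE) as [-> ->]. reflexivity.
  - intros HI HT. unfold amplitudes, transmission. rewrite the_none; [reflexivity|].
    intros [[[T1 T2] R1] R2] H. apply Heq in H as [H _].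
    apply reduced_of_scatters in H; trivial.
    destruct (Tfun_cases psi (cos theta) Hpsi Hc) as [[H' _]|[_ Hn]]; [exact (H' HT)|].
    apply (scatters_scal _ _ _ (/ I1)) in H. rewrite Cinv_l in H by trivial.
    exact (Hn _ _ H).
Qed.

Lemma Stokes_amplitudes (psi : R -> R) (I1 I2 : C) (theta : R) :
  Stokes eta eperp epar psi (fun _ => 0) I1 I2 theta =
  let '(T1, T2) := amplitudes psi I1 I2 theta in
  (Cmod T1 ^ 2 + Cmod T2 ^ 2, Cmod T1 ^ 2 - Cmod T2 ^ 2, (2 * T1 * Cconj T2)%C).
Proof.
  unfold Stokes, amplitudes.
  destruct (transmission eta eperp epar psi (fun _ => 0) I1 I2 theta) as [[[T1 T2] R1] R2].
  reflexivity.
Qed.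

Lemma Ffun_phase_pos (psi : R -> R) (theta : R) :
  0 <= sin theta ->
  Ffun eta eperp epar psi (cos theta) = Cexpi (phase eta eperp epar psi theta 1).
Proof.
  intros Hs. unfold Ffun, phase. do 3 f_equal.
  apply sqrt_lem_1; trivial.
  - generalize (COS_bound theta). nra.
  - generalize (sin2_cos2 theta). unfold Rsqr. lra.
Qed.

Lemma Ffun_phase_neg (psi : R -> R) (theta : R) :
  sin theta <= 0 ->
  (/ Ffun eta eperp epar psi (cos theta))%C = Cexpi (phase eta eperp epar psi theta 1).
Proof.
  intros Hs. rewrite <- (cos_neg theta), Ffun_phase_pos by (rewrite sin_neg; lra).
  rewrite <- Cexpi_inv. f_equal. unfold phase. rewrite sin_neg. ring.
Qed.

Lemma Stokes_determines_T (psi1 psi2 : R -> R) (theta : R) :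
  piecewise_continuous psi1 -> piecewise_continuous psi2 -> 0 < cos theta ->
  Stokes eta eperp epar psi1 (fun _ => 0) 1 1 theta =
  Stokes eta eperp epar psi2 (fun _ => 0) 1 1 theta ->
  (Tfun eta eperp epar psi1 (cos theta) * Cexpi (phase eta eperp epar psi1 theta 1) =
   Tfun eta eperp epar psi2 (cos theta) * Cexpi (phase eta eperp epar psi2 theta 1))%C.
Proof.
  intros Hpsi1 Hpsi2 Hc. rewrite !Stokes_amplitudes.
  destruct (amplitudes_planar theta Hc) as (te & Hte & HA).
  destruct (HA psi1 1 1 Hpsi1) as [A1 A1']. destruct (HA psi2 1 1 Hpsi2) as [A2 A2'].
  assert (Habs : forall x : C, Cmod x ^ 2 + Cmod (1 * te) ^ 2 <> Cmod 0 ^ 2 + Cmod 0 ^ 2).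
  { intros x E. rewrite Cmult_1_l, Cmod_0 in E.
    generalize (Cmod_gt_0 te). intros [H _]. specialize (H Hte).
    generalize (pow2_ge_0 (Cmod x)). nra. }
  destruct (classic (Tfun eta eperp epar psi1 (cos theta) = 0)) as [E1|E1];
    destruct (classic (Tfun eta eperp epar psi2 (cos theta) = 0)) as [E2|E2].
  - intros _. rewrite E1, E2. ring.
  - rewrite A1', A2 by (auto using C1_nz). intros H. apply (f_equal (fun x => fst (fst x))) in H.
    destruct (Habs _ (eq_sym H)).
  - rewrite A1, A2' by (auto using C1_nz). intros H. apply (f_equal (fun x => fst (fst x))) in H.
    destruct (Habs _ H).
  - rewrite A1, A2 by auto. intros H. apply (f_equal snd) in H. simpl in H.
    assert (Hte' : Cconj te <> 0).
    { intros E. apply Hte. rewrite <- (Cconj_conj te), E. apply injective_projections; simpl; ring. }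
    rewrite !Cmult_1_l in H.
    match goal with |- ?x = ?y =>
      replace x with ((2 * x * Cconj te) / (2 * Cconj te))%C
        by (field; exact Hte');
      replace y with ((2 * y * Cconj te) / (2 * Cconj te))%C
        by (field; exact Hte')
    end.
    now rewrite H.
Qed.

Lemma same_Stokes_iff (psi1 psi2 : R -> R) :
  piecewise_continuous psi1 -> piecewise_continuous psi2 ->
  same_Stokes eta eperp epar psi1 (fun _ => 0) psi2 (fun _ => 0) <->
  same_TF eta eperp epar psi1 psi2.
Proof.
  intros Hpsi1 Hpsi2. split.
  - intros HS la Hla.
    assert (Hcos : cos (acos la) = la) by (apply cos_acos; lra).
    assert (Hacos : 0 <= acos la < PI / 2).
    { generalize (acos_bound la). intros Hb. split; [lra|].
      apply Rnot_le_lt. intros H. generalize (cos_le_0 (acos la) H). lra. }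
    assert (Hcos' : cos (- acos la) = la) by now rewrite cos_neg.
    assert (Hsin : 0 <= sin (acos la)) by (apply sin_ge_0; lra).
    assert (Hsin' : sin (- acos la) <= 0) by (rewrite sin_neg; lra).
    split.
    + generalize (Stokes_determines_T psi1 psi2 (acos la) Hpsi1 Hpsi2).
      rewrite <- !Ffun_phase_pos, Hcos by trivial. intros H. apply H; [lra|].
      apply HS; lra.
    + generalize (Stokes_determines_T psi1 psi2 (- acos la) Hpsi1 Hpsi2).
      rewrite <- !Ffun_phase_neg, Hcos' by trivial. intros H. apply H; [lra|].
      apply HS; lra.
  - intros HT I1 I2 theta Hth.
    assert (Hc : 0 < cos theta) by (apply cos_gt_0; lra).
    assert (Hc1 : cos theta <= 1) by (generalize (COS_bound theta); lra).
    assert (HE : (Tfun eta eperp epar psi1 (cos theta) * Cexpi (phase eta eperp epar psi1 theta 1) =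
       Tfun eta eperp epar psi2 (cos theta) * Cexpi (phase eta eperp epar psi2 theta 1))%C).
    { destruct (HT (cos theta)) as [H1 H2]; [lra|].
      destruct (Rle_dec 0 (sin theta)) as [Hs|Hs].
      - rewrite <- !Ffun_phase_pos by trivial. exact H1.
      - rewrite <- !Ffun_phase_neg by lra. exact H2. }
    rewrite !Stokes_amplitudes.
    destruct (amplitudes_planar theta Hc) as (te & Hte & HA).
    destruct (HA psi1 I1 I2 Hpsi1) as [A1 A1']. destruct (HA psi2 I1 I2 Hpsi2) as [A2 A2'].
    enough (amplitudes psi1 I1 I2 theta = amplitudes psi2 I1 I2 theta) as -> by reflexivity.
    destruct (classic (I1 = 0)) as [HI|HI].
    { rewrite A1, A2, HE by auto. reflexivity. }
    assert (Hz : Tfun eta eperp epar psi1 (cos theta) = 0 <->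
                 Tfun eta eperp epar psi2 (cos theta) = 0).
    { split; intros E; rewrite E, Cmult_0_l in HE;
        eapply Cmult_Cexpi_eq_0; [symmetry|]; exact HE. }
    destruct (classic (Tfun eta eperp epar psi1 (cos theta) = 0)) as [E|E].
    + rewrite A1', A2' by tauto. reflexivity.
    + rewrite A1, A2, HE by tauto. reflexivity.
Qed.

End Planar.

Lemma tilt_angle_continuous (psi : R -> R) :
  (forall t, continuous psi t) ->
  (forall t, unit_interval t -> - (PI / 2) < psi t <= PI / 2) -> tilt_angle psi.
Proof.
  intros Hc Hb. split; trivial. split; [|split].
  - exists nil. auto.
  - intros t _. exists (psi t). apply filterlim_filter_le_1 with (2 := Hc t). apply filter_le_within.
  - intros t _. exists (psi t). apply filterlim_filter_le_1 with (2 := Hc t). apply filter_le_within.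
Qed.

Lemma azimuthal_angle_const (c : R) : 0 <= c < PI -> azimuthal_angle (fun _ => c).
Proof.
  intros Hc. split; auto. split; [|split].
  - exists nil. intros t _ _. apply continuous_const.
  - intros t _. exists c. apply filterlim_const.
  - intros t _. exists c. apply filterlim_const.
Qed.

Lemma infinitely_many_times (l : list R) : exists t, 0 < t < / 2 /\ ~ In t l.
Proof.
  destruct (locally_not_in l (/ 4)) as [e He].
  set (r := Rmin (e / 2) (/ 8)).
  assert (Hr : 0 < r <= / 8 /\ r < e).
  { unfold r, Rmin. generalize (cond_pos e). destruct Rle_dec; lra. }
  exists (/ 4 + r). split; [lra|]. apply He; [|lra].
  unfold ball; simpl; unfold AbsRing_ball, abs, minus, plus, opp; simpl.
  replace (/ 4 + r + - / 4) with r by ring. rewrite Rabs_pos_eq; lra.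
Qed.

(* At tilt [PI / 2] the director is vertical, so the azimuth is irrelevant. *)
Lemma Stokes_vertical (eta eperp epar : R) (x y : R) :
  same_Stokes eta eperp epar (fun _ => PI / 2) (fun _ => x) (fun _ => PI / 2) (fun _ => y).
Proof.
  intros I1 I2 theta _.
  assert (He : epst eperp epar (PI / 2) x = epst eperp epar (PI / 2) y).
  { apply functional_extensionality; intros i. apply functional_extensionality; intros j.
    unfold epst, eps.
    assert (Hdir : forall k, director (PI / 2) x k = director (PI / 2) y k).
    { intros [|[|k]]; simpl; rewrite ?cos_PI2; ring. }
    now rewrite !Hdir. }
  unfold Stokes, transmission, transmission_solution, Bmat. now rewrite He.
Qed.

Lemma Tfun_opp (eta eperp epar : R) (psi : R -> R) (la : R) :
  Tfun eta eperp epar (fun t => - psi t) la = Tfun eta eperp epar psi la.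
Proof.
  set (d := delta eperp epar).
  assert (Hcos : forall x, cos (2 * - x) = cos (2 * x)).
  { intros x. rewrite Ropp_mult_distr_r_reverse. apply cos_neg. }
  assert (Hw : (fun s => / (1 + d * cos (2 * - psi s))) =
               (fun s => / (1 + d * cos (2 * psi s)))).
  { apply functional_extensionality; intros s. now rewrite Hcos. }
  assert (HN : Ncal d (fun t => - psi t) = Ncal d psi) by (unfold Ncal; now rewrite Hw).
  assert (Hmu : mu d (fun t => - psi t) = mu d psi).
  { apply functional_extensionality; intros s. unfold mu, tau. now rewrite HN, Hw. }
  assert (Hred : reduced_solution eta d (fun t => - psi t) la = reduced_solution eta d psi la).
  { apply functional_extensionality; intros u. apply functional_extensionality; intros v.
    unfold reduced_solution, eta_tilde. rewrite HN, Hmu.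
    replace (fun t => la ^ 2 + d / sqrt (1 - d ^ 2) *
             (cos (2 * - psi (mu d psi t)) + d / (1 + sqrt (1 - d ^ 2))))
      with (fun t => la ^ 2 + d / sqrt (1 - d ^ 2) *
             (cos (2 * psi (mu d psi t)) + d / (1 + sqrt (1 - d ^ 2)))).
    - apply propositional_extensionality.
      split; intros (Hu & Hv & H); (split; [exact Hu|split; [exact Hv|]]);
        intros t Ht Hq; destruct (H t Ht Hq) as (du & dv & D);
        exists du, dv; rewrite Hcos in *; exact D.
    - apply functional_extensionality; intros t. now rewrite Hcos. }
  unfold Tfun, reduced_transmission. fold d. now rewrite Hred.
Qed.

Lemma RInt_odd_half (g : R -> R) :
  (forall x, continuous g x) -> (forall x, g (- x) = - g x) ->
  RInt (fun s => g (s - / 2)) 0 1 = 0 /\ RInt (fun s => g (- (s - / 2))) 0 1 = 0.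
Proof.
  intros Hg Hodd.
  assert (Hex : ex_RInt (fun s => g (s - / 2)) 0 1).
  { apply (ex_RInt_continuous (V := R_CompleteNormedModule)). intros z _.
    apply (continuous_comp (fun s => s - / 2) g); [|apply Hg].
    apply (ex_derive_continuous (V := R_NormedModule)). auto_derive. trivial. }
  assert (H1 : RInt (fun s => g (- (s - / 2))) 0 1 = - RInt (fun s => g (s - / 2)) 0 1).
  { rewrite <- (RInt_opp (V := R_CompleteNormedModule)) by exact Hex.
    apply RInt_ext. intros x _. apply Hodd. }
  assert (H2 : RInt (fun s => g (- (s - / 2))) 0 1 = RInt (fun s => g (s - / 2)) 0 1).
  { assert (H := RInt_comp_lin (V := R_CompleteNormedModule) (fun s => g (s - / 2)) (-1) 1 0 1).
    replace (-1 * 0 + 1) with 1 in H by ring. replace (-1 * 1 + 1) with 0 in H by ring.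
    specialize (H (ex_RInt_swap _ _ _ Hex)).
    rewrite <- (opp_RInt_swap (V := R_CompleteNormedModule) (fun s => g (s - / 2)) 0 1) in H by exact Hex.
    rewrite (RInt_ext _ (fun s => opp (g (- (s - / 2))))) in H.
    2: { intros x _. unfold scal, opp; simpl; unfold mult; simpl.
         replace (-1 * x + 1 - / 2) with (- (x - / 2)) by field. ring. }
    rewrite (RInt_opp (V := R_CompleteNormedModule)) in H.
    - unfold opp in H; simpl in H. lra.
    - apply (ex_RInt_continuous (V := R_CompleteNormedModule)). intros z _.
      apply (continuous_comp (fun s => - (s - / 2)) g); [|apply Hg].
      apply (ex_derive_continuous (V := R_NormedModule)). auto_derive. trivial. }
  lra.
Qed.

Lemma same_TF_reflection (eta eperp epar : R) :
  0 < eperp -> 0 < epar ->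
  same_TF eta eperp epar (fun t => - (t - / 2)) (fun t => t - / 2).
Proof.
  intros H1 H2 la Hla. assert (Hd := delta_bounds _ _ H1 H2).
  set (d := delta eperp epar) in *.
  destruct (RInt_odd_half (jfun d)) as [E1 E2].
  - intros x. now apply continuous_jfun.
  - intros x. unfold jfun. replace (2 * - x) with (- (2 * x)) by ring.
    rewrite sin_neg, cos_neg. unfold Rdiv. ring.
  - unfold jfun in E1, E2. unfold Ffun. fold d.
    rewrite (Tfun_opp eta eperp epar (fun t => t - / 2)), E1, E2. split; reflexivity.
Qed.

Theorem proposition5 :
  forall eta eperp epar : R, 0 < eta -> 0 < eperp -> 0 < epar ->
    (exists psi1 phi1 psi2 phi2 : R -> R,
       tilt_angle psi1 /\ azimuthal_angle phi1 /\
       tilt_angle psi2 /\ azimuthal_angle phi2 /\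
       distinct (fun t => (psi1 t, phi1 t)) (fun t => (psi2 t, phi2 t)) /\
       same_Stokes eta eperp epar psi1 phi1 psi2 phi2) /\
    (forall psi1 psi2 : R -> R, tilt_angle psi1 -> tilt_angle psi2 ->
       (same_Stokes eta eperp epar psi1 (fun _ => 0) psi2 (fun _ => 0) <->
        same_TF eta eperp epar psi1 psi2)) /\
    (exists psi1 psi2 : R -> R,
       tilt_angle psi1 /\ tilt_angle psi2 /\ distinct psi1 psi2 /\
       same_TF eta eperp epar psi1 psi2).
Proof.
  intros eta eperp epar Heta Hperp Hpar.
  assert (HPI := PI2_3_2).
  split; [|split].
  - exists (fun _ => PI / 2), (fun _ => 0), (fun _ => PI / 2), (fun _ => 1).
    assert (Htilt : tilt_angle (fun _ => PI / 2)).
    { apply tilt_angle_continuous; [intros t; apply continuous_const|intros; lra]. }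
    split; [|split; [|split; [|split; [|split]]]]; trivial.
    + apply azimuthal_angle_const; lra.
    + apply azimuthal_angle_const; lra.
    + intros l. destruct (infinitely_many_times l) as (t & Ht & Hi). exists t.
      split; [unfold unit_interval; lra|split; trivial]. intros E. injection E. lra.
    + apply Stokes_vertical.
  - intros psi1 psi2 [H1 _] [H2 _]. now apply same_Stokes_iff.
  - exists (fun t => - (t - / 2)), (fun t => t - / 2).
    split; [|split; [|split]].
    + apply tilt_angle_continuous; [|unfold unit_interval; intros; lra].
      intros t. apply (ex_derive_continuous (V := R_NormedModule)). auto_derive. trivial.
    + apply tilt_angle_continuous; [|unfold unit_interval; intros; lra].
      intros t. apply (ex_derive_continuous (V := R_NormedModule)). auto_derive. trivial.
    + intros l. destruct (infinitely_many_times l) as (t & Ht & Hi). exists t.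
      split; [unfold unit_interval; lra|split; trivial]. lra.
    + now apply same_TF_reflection.
Qed.
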